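(* Assuming the Exponential Time Hypothesis, there is no $2^{o(k\log k)}\cdot n^{O(1)}$ time algorithm for $k\times k$ Hitting Set, even in the special case when each set contains at most one element from each row.
   Context: The $k\times k$ Hitting Set problem: given sets $S_1,\dots,S_m\subseteq[k]\times[k]$ (where $(i,j)$ is the cell in row $i$, column $j$), with parameter $k$, decide whether there is a set $S$ containing exactly one element from each row (i.e. $S=\{(1,\rho(1)),\dots,(k,\rho(k))\}$ for some mapping $\rho:[k]\to[k]$) such that $S\cap S_i\ne\emptyset$ for every $1\le i\le m$. Here $n$ denotes the input size. The Exponential Time Hypothesis (ETH) states that there is no $2^{o(n)}$ time algorithm for 3SAT on $n$ variables. *)

(* Defs.v *)
From mathcomp Require Import all_boot.

Set Implicit Arguments.
Unset Strict Implicit.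
Unset Printing Implicit Defensive.

(* Model of computation: Jones' WHILE language over binary trees.  A tree value
   is a pointer to an immutable pair, so each of the constructors of [expr] is a
   constant-time operation and assignment copies a pointer; this is the
   uniform-cost LISP/pointer machine.  WHILE programs and multi-tape Turing
   machines simulate each other with polynomial overhead, and all the time
   bounds below are insensitive to polynomial overhead. *)

Inductive tree : Type := Leaf | Node of tree & tree.

Fixpoint tsize (t : tree) : nat :=
  if t is Node l r then (tsize l + tsize r).+1 else 1.

Inductive expr : Type :=
  | EVar of nat
  | ENil
  | ECons of expr & expr
  | EHd of expr
  | ETl of expr.

Inductive cmd : Type :=
  | Assign of nat & expr
  | Seq of cmd & cmd
  | If of expr & cmd & cmd
  | While of expr & cmd.

Definition store : Type := nat -> tree.

Definition update (s : store) (x : nat) (v : tree) : store :=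
  fun y => if y == x then v else s y.

Fixpoint eval (s : store) (e : expr) : tree :=
  match e with
  | EVar x => s x
  | ENil => Leaf
  | ECons e1 e2 => Node (eval s e1) (eval s e2)
  | EHd e1 => if eval s e1 is Node l _ then l else Leaf
  | ETl e1 => if eval s e1 is Node _ r then r else Leaf
  end.

Fixpoint ecost (e : expr) : nat :=
  match e with
  | EVar _ | ENil => 1
  | ECons e1 e2 => (ecost e1 + ecost e2).+1
  | EHd e1 | ETl e1 => (ecost e1).+1
  end.

(* [exec c s t s']: started in store s, the program c halts after exactly t
   elementary steps in store s'.  [Leaf] is false, every [Node] is true. *)
Inductive exec : cmd -> store -> nat -> store -> Prop :=
  | ExecAssign x e s :
      exec (Assign x e) s (ecost e).+1 (update s x (eval s e))
  | ExecSeq c1 c2 s s1 s2 t1 t2 :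
      exec c1 s t1 s1 -> exec c2 s1 t2 s2 ->
      exec (Seq c1 c2) s (t1 + t2) s2
  | ExecIfTrue e c1 c2 s s1 t :
      eval s e <> Leaf -> exec c1 s t s1 ->
      exec (If e c1 c2) s ((ecost e).+1 + t) s1
  | ExecIfFalse e c1 c2 s s1 t :
      eval s e = Leaf -> exec c2 s t s1 ->
      exec (If e c1 c2) s ((ecost e).+1 + t) s1
  | ExecWhileFalse e c s :
      eval s e = Leaf -> exec (While e c) s (ecost e).+1 s
  | ExecWhileTrue e c s s1 s2 t1 t2 :
      eval s e <> Leaf -> exec c s t1 s1 -> exec (While e c) s1 t2 s2 ->
      exec (While e c) s ((ecost e).+1 + t1 + t2) s2.

Lemma exec_det c s t1 s1 t2 s2 :
  exec c s t1 s1 -> exec c s t2 s2 -> t1 = t2 /\ s1 = s2.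
Proof.
move=> H; elim: H t2 s2 => {c s t1 s1}.
- by move=> x e s t2 s2 H; inversion H.
- move=> c1 c2 s s1 s2 t1 t2 _ IH1 _ IH2 t3 s3 H.
  inversion H as [|? ? ? ? ? ? ? E1 E2| | | |]; subst.
  case: (IH1 _ _ E1) => ? ?; subst.
  by case: (IH2 _ _ E2) => ? ?; subst.
- move=> e c1 c2 s s1 t He _ IH t3 s3 H.
  inversion H as [| |? ? ? ? ? ? ? E| | |]; subst => //.
  by case: (IH _ _ E) => ? ?; subst.
- move=> e c1 c2 s s1 t He _ IH t3 s3 H.
  inversion H as [| | |? ? ? ? ? ? ? E| |]; subst => //.
  by case: (IH _ _ E) => ? ?; subst.
- by move=> e c s He t3 s3 H; inversion H.
- move=> e c s s1 s2 t1 t2 He _ IH1 _ IH2 t3 s3 H.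
  inversion H as [| | | | |? ? ? ? ? ? ? ? E1 E2]; subst => //.
  case: (IH1 _ _ E1) => ? ?; subst.
  by case: (IH2 _ _ E2) => ? ?; subst.
Qed.

(* Input and output are passed in variable 0. *)
Definition init (v : tree) : store := update (fun=> Leaf) 0 v.

(* p decides [yes] in time T on the instances satisfying the promise [valid];
   its behaviour on other inputs is unconstrained. *)
Definition decides_in_time (I : Type) (enc : I -> tree) (valid yes : I -> Prop)
    (T : I -> nat) (p : cmd) : Prop :=
  forall x, valid x ->
    exists t s, [/\ exec p (init (enc x)) t s, t <= T x & s 0 <> Leaf <-> yes x].

(* The usual definition, with epsilon = 1 / c. *)
Definition little_o (g f : nat -> nat) : Prop :=
  forall c, exists n0, forall n, n0 <= n -> c * g n <= f n.

Definition enc_nat (n : nat) : tree := iter n (Node Leaf) Leaf.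

Definition enc_bool (b : bool) : tree := if b then Node Leaf Leaf else Leaf.

Definition enc_seq (A : Type) (enc : A -> tree) (s : seq A) : tree :=
  foldr (fun a t => Node (enc a) t) Leaf s.

(* (x, true) is the literal x and (x, false) is its negation. *)
Definition literal (n : nat) : Type := ('I_n * bool)%type.

Record cnf : Type := Cnf {
  nvars : nat;
  clauses : seq (seq (literal nvars))
}.

Definition satisfiable (F : cnf) : Prop :=
  exists a : 'I_(nvars F) -> bool,
    forall C, C \in clauses F -> exists2 l, l \in C & a l.1 = l.2.

(* No clause is listed twice: the number of clauses, hence the input size, must
   be bounded in terms of n for a 2^o(n) running time to make sense. *)
Definition is_3cnf (F : cnf) : Prop :=
  uniq (clauses F) /\ forall C, C \in clauses F -> size C <= 3.

(* Unary numbers cost only a factor polynomial in n (below: in k), which is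
   absorbed by 2^o(n) (resp. 2^o(k log k)). *)
Definition enc_literal (n : nat) (l : literal n) : tree :=
  Node (enc_nat l.1) (enc_bool l.2).

Definition enc_cnf (F : cnf) : tree :=
  Node (enc_nat (nvars F)) (enc_seq (enc_seq (@enc_literal _)) (clauses F)).

Definition ETH : Prop :=
  ~ exists (p : cmd) (g : nat -> nat),
      little_o g (fun n => n) /\
      decides_in_time enc_cnf is_3cnf satisfiable (fun F => 2 ^ g (nvars F)) p.

(* (row, column) *)
Definition cell (k : nat) : Type := ('I_k * 'I_k)%type.

(* Each of the sets is presented by a list of its elements, in any order. *)
Record hs_instance : Type := HSInstance {
  hs_k : nat;
  hs_sets : seq (seq (cell hs_k))
}.

Definition has_hitting_set (H : hs_instance) : Prop :=
  exists rho : 'I_(hs_k H) -> 'I_(hs_k H),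
    forall S, S \in hs_sets H -> exists i, (i, rho i) \in S.

Definition at_most_one_per_row (H : hs_instance) : Prop :=
  forall S, S \in hs_sets H ->
  forall c d, c \in S -> d \in S -> c.1 = d.1 -> c = d.

Definition enc_cell (k : nat) (c : cell k) : tree :=
  Node (enc_nat c.1) (enc_nat c.2).

Definition enc_hs (H : hs_instance) : tree :=
  Node (enc_nat (hs_k H)) (enc_seq (enc_seq (@enc_cell _)) (hs_sets H)).

(* There is a 2^o(k log k) * n^O(1) time algorithm for k x k Hitting Set
   restricted to the instances in [valid].  [trunc_log 2] is the floor of the
   binary logarithm, which does not change the class o(k log k). *)
Definition hs_solvable (valid : hs_instance -> Prop) : Prop :=
  exists (p : cmd) (g : nat -> nat) (c : nat),
    little_o g (fun k => k * trunc_log 2 k) /\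
    decides_in_time enc_hs valid has_hitting_set
      (fun H => 2 ^ g (hs_k H) * tsize (enc_hs H) ^ c) p.

(* Main.v *)
Require Import Defs.
From mathcomp Require Import all_boot zify.

(** Let [b] be least with [n < 2 ^ b * b] and [q := 2 ^ b].  The [n] variables
    are distributed over [q] groups of [b] variables each, and [k := 3 * q], so
    that [k * log k = O(n)].  Rows and columns are split into three classes of
    [q]; column [j] of a class stands for group [j], every row carries a label,
    i.e. an assignment of [b] bits, and the value of group [j] in a class is the
    label of the row that [rho] sends to its column.  The literal "position [t]
    of group [j] has value [sg]" then is the set of the cells [(r, j)] such that
    bit [t] of the label of [r] is [sg]; it lies in one column and so is thin.
    The three literals of a clause are taken from the three classes, which makes
    their union thin too.  The sets [x or not x'], with [x] and [x'] copies of
    one variable in any two classes, make the classes agree; for equal classes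
    they say that each column is hit, so that [rho] is a permutation.

    A permutation realises an assignment iff each label is carried by as many
    rows as there are groups with that value.  The reduction tries all the
    multisets of [q] labels: each is coded by [2 * q] bits, which makes only
    [2 ^ (2 * q) = 2 ^ o(n)] calls.  In particular the number of clauses plays
    no role and no sparsification is needed. *)

Set Implicit Arguments.
Unset Strict Implicit.
Unset Printing Implicit Defensive.

(** * Straight-line and loop programs with a running time bound *)

(* A [tm] is instantiated at a depth [d]: its code leaves the variables below [d]
   unchanged, may use those from [d] on as scratch, and puts its result in [d]. *)
Definition tm : Type := nat -> cmd.

Definition agree (G : seq tree) (s : store) : Prop :=
  forall i, i < size G -> s i = nth Leaf G i.

Definition ext (G G' : seq tree) : Prop := exists D, G' = G ++ D.

(* [G] lists the values of the variables in scope.  Quantifying over the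
   extensions of [G] makes the judgement stable when binders add variables, and
   measuring time by powers of a fixed [X] makes all bounds numerals. *)
Definition runs (X : nat) (G : seq tree) (a : tm) (v : tree) (C : nat) : Prop :=
  forall G' s, ext G G' -> agree G' s ->
  exists t s', [/\ exec (a (size G')) s t s', t <= X ^ C,
    s' (size G') = v & forall i, i < size G' -> s' i = s i].

Lemma ext_refl G : ext G G.
Proof. by exists [::]; rewrite cats0. Qed.

Lemma ext_trans G1 G2 G3 : ext G1 G2 -> ext G2 G3 -> ext G1 G3.
Proof. by move=> [D1 ->] [D2 ->]; exists (D1 ++ D2); rewrite catA. Qed.

Lemma ext_cat G D : ext G (G ++ D).
Proof. by exists D. Qed.

Lemma runs_ext X G G' a v C : ext G G' -> runs X G a v C -> runs X G' a v C.
Proof. by move=> e H G2 s e2; apply: H; apply: ext_trans e2. Qed.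

Lemma updateE s x v : update s x v x = v.
Proof. by rewrite /update eqxx. Qed.

Lemma update_neq s x v y : y != x -> update s x v y = s y.
Proof. by rewrite /update => /negbTE ->. Qed.

Lemma agree_ext G s s' :
  agree G s -> (forall i, i < size G -> s' i = s i) -> agree G s'.
Proof. by move=> H E i hi; rewrite E // H. Qed.

Lemma agree_rcons G s v : agree G s -> s (size G) = v -> agree (rcons G v) s.
Proof.
move=> H E i; rewrite size_rcons ltnS leq_eqVlt nth_rcons.
by case/orP=> [/eqP -> |hi]; rewrite ?ltnn ?eqxx // hi H.
Qed.

Definition VAR (k : nat) : tm := fun d => Assign d (EVar k).
Definition NIL : tm := fun d => Assign d ENil.
Definition CONS (a b : tm) : tm := fun d =>
  Seq (a d) (Seq (b d.+1) (Assign d (ECons (EVar d) (EVar d.+1)))).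
Definition HD (a : tm) : tm := fun d => Seq (a d) (Assign d (EHd (EVar d))).
Definition TL (a : tm) : tm := fun d => Seq (a d) (Assign d (ETl (EVar d))).
Definition IF (c a b : tm) : tm := fun d => Seq (c d) (If (EVar d) (a d) (b d)).
(** Binders are functions of the metalanguage: the body receives the code that reads the bound
    variable and runs one level deeper. *)
Definition LET (a : tm) (f : tm -> tm) : tm := fun d =>
  Seq (a d) (Seq (f (VAR d) d.+1) (Assign d (EVar d.+1))).
(** Layout: [d] holds the rest of the list, [d.+1] the accumulator, [d.+2] the current element, and
    the body starts at [d.+3]. *)
Definition FOLD (l i : tm) (f : tm -> tm -> tm) : tm := fun d =>
  Seq (l d) (Seq (i d.+1) (Seq
    (While (EVar d)
      (Seq (Assign d.+2 (EHd (EVar d)))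
      (Seq (Assign d (ETl (EVar d)))
      (Seq (f (VAR d.+1) (VAR d.+2) d.+3)
           (Assign d.+1 (EVar d.+3))))))
    (Assign d (EVar d.+1)))).

Section Rules.
Variables (X : nat) (X2 : 1 < X).
Implicit Types (G : seq tree) (a b c : tm) (u v : tree).

Lemma leq_powX k : k <= X ^ k.
Proof. by rewrite ltnW // ltn_expl. Qed.

(** Both summands are at most [X ^ (k + m)], and the extra factor [X >= 2] pays for their sum. *)
Lemma leq_pow_add x y k m : x <= X ^ k -> y <= X ^ m -> x + y <= X ^ (k + m).+1.
Proof.
move=> hx hy; rewrite expnS.
have: X ^ k <= X ^ (k + m) by rewrite leq_pexp2l ?leq_addr // ltnW.
have: X ^ m <= X ^ (k + m) by rewrite leq_pexp2l ?leq_addl // ltnW.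
by move: X2; nia.
Qed.

Lemma leq_pow_mul x y k m : x <= X ^ k -> y <= X ^ m -> x * y <= X ^ (k + m).
Proof. by move=> hx hy; rewrite expnD leq_mul. Qed.

Lemma leq_powW x k m : x <= X ^ k -> k <= m -> x <= X ^ m.
Proof. by move=> h km; apply: leq_trans h _; rewrite leq_pexp2l // ltnW. Qed.

Lemma leq4_powX : 4 <= X ^ 2.
Proof. by rewrite (leq_exp2r 2 _ (isT : 0 < 2)). Qed.

Lemma runs_weak G a v k m : runs X G a v k -> k <= m -> runs X G a v m.
Proof.
move=> H km G' s e A; have [t [s' [h1 h2 h3 h4]]] := H _ _ e A.
by exists t, s'; split=> //; apply: leq_powW h2 km.
Qed.

Lemma runs_var G k : k < size G -> runs X G (VAR k) (nth Leaf G k) 1.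
Proof.
move=> hk G' s [D ->] A; set d := size _.
exists 2, (update s d (s k)); split; first exact: (ExecAssign d (EVar k) s).
- by rewrite expn1.
- by rewrite updateE A ?nth_cat ?hk // size_cat ltn_addr.
- by move=> i hi; rewrite update_neq // neq_ltn hi.
Qed.

Lemma runs_nil G : runs X G NIL Leaf 1.
Proof.
move=> G' s e A; set d := size _.
exists 2, (update s d Leaf); split; first exact: (ExecAssign d ENil s).
- by rewrite expn1.
- by rewrite updateE.
- by move=> i hi; rewrite update_neq // neq_ltn hi.
Qed.

Lemma runs_cons G a b u v k m : runs X G a u k -> runs X G b v m ->
  runs X G (CONS a b) (Node u v) (k + m).+4.
Proof.
move=> Ha Hb G' s e A; set d := size _.
have [t1 [s1 [E1 le1 V1 F1]]] := Ha _ _ e A.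
have A1 : agree (rcons G' u) s1 by apply: agree_rcons => //; apply: agree_ext F1.
have e1 : ext G (rcons G' u) by rewrite -cats1; apply: ext_trans e (ext_cat _ _).
have [t2 [s2 [E2 le2 V2 F2]]] := Hb _ _ e1 A1.
rewrite size_rcons in E2 V2 F2.
exists (t1 + (t2 + 4)), (update s2 d (Node (s2 d) (s2 d.+1))); split.
- apply: ExecSeq E1 _; apply: ExecSeq E2 _.
  exact: (ExecAssign d (ECons (EVar d) (EVar d.+1)) s2).
- rewrite addnA; apply: leq_powW (leq_pow_add (leq_pow_add le1 le2) leq4_powX) _; lia.
- by rewrite updateE V2 F2 // V1.
- move=> i hi; rewrite update_neq; last by rewrite neq_ltn hi.
  by rewrite F2 ?F1 // ltnW.
Qed.

Lemma runs_hd G a v k : runs X G a v k ->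
  runs X G (HD a) (if v is Node l _ then l else Leaf) k.+3.
Proof.
move=> Ha G' s e A; set d := size _.
have [t1 [s1 [E1 le1 V1 F1]]] := Ha _ _ e A.
exists (t1 + 3), (update s1 d (if s1 d is Node l _ then l else Leaf)); split.
- by apply: ExecSeq E1 _; exact: (ExecAssign d (EHd (EVar d)) s1).
- by apply: leq_powW (leq_pow_add le1 (ltnW leq4_powX)) _; lia.
- by rewrite updateE V1.
- by move=> i hi; rewrite update_neq ?F1 // neq_ltn hi.
Qed.

Lemma runs_tl G a v k : runs X G a v k ->
  runs X G (TL a) (if v is Node _ r then r else Leaf) k.+3.
Proof.
move=> Ha G' s e A; set d := size _.
have [t1 [s1 [E1 le1 V1 F1]]] := Ha _ _ e A.
exists (t1 + 3), (update s1 d (if s1 d is Node _ r then r else Leaf)); split.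
- by apply: ExecSeq E1 _; exact: (ExecAssign d (ETl (EVar d)) s1).
- by apply: leq_powW (leq_pow_add le1 (ltnW leq4_powX)) _; lia.
- by rewrite updateE V1.
- by move=> i hi; rewrite update_neq ?F1 // neq_ltn hi.
Qed.

(** Each branch is analysed only under the outcome of the test that leads to it; adding the two
    bounds avoids a maximum. *)
Lemma runs_if G c a b u v k m1 m2 : runs X G c u k ->
  (u <> Leaf -> runs X G a v m1) -> (u = Leaf -> runs X G b v m2) ->
  runs X G (IF c a b) v (k + m1 + m2).+3.
Proof.
move=> Hc Ha Hb G' s e A; set d := size _.
have [t1 [s1 [E1 le1 V1 F1]]] := Hc _ _ e A.
have A1 := agree_ext A F1.
have: exists t2 s2, [/\ exec (If (EVar d) (a d) (b d)) s1 (2 + t2) s2,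
    t2 <= X ^ (m1 + m2), s2 d = v & forall i, i < d -> s2 i = s1 i].
  have: u = Leaf \/ u <> Leaf by case: (u); [left | right].
  case=> hu.
    have [t2 [s2 [E2 le2 V2 F2]]] := Hb hu _ _ e A1.
    exists t2, s2; split=> //; last by apply: leq_powW le2 _; rewrite leq_addl.
    by apply: (ExecIfFalse (e := EVar d)) => //=; rewrite -/d V1.
  have [t2 [s2 [E2 le2 V2 F2]]] := Ha hu _ _ e A1.
  exists t2, s2; split=> //; last by apply: leq_powW le2 _; rewrite leq_addr.
  by apply: (ExecIfTrue (e := EVar d)) => //=; rewrite -/d V1.
move=> [t2 [s2 [E2 le2 V2 F2]]].
exists (t1 + (2 + t2)), s2; split=> //; first exact: ExecSeq E1 E2.
- have h2 : 2 <= X ^ 1 by rewrite expn1.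
  by apply: leq_powW (leq_pow_add le1 (leq_pow_add h2 le2)) _; lia.
- by move=> i hi; rewrite F2 // F1.
Qed.

(** The body is specified for every code [x] that yields [u], so its analysis never mentions a
    variable index. *)
Lemma runs_let G a f u v k m : runs X G a u k ->
  (forall G' x, ext G G' -> runs X G' x u 1 -> runs X G' (f x) v m) ->
  runs X G (LET a f) v (k + m).+3.
Proof.
move=> Ha Hf G' s e A; set d := size _.
have [t1 [s1 [E1 le1 V1 F1]]] := Ha _ _ e A.
have A1 : agree (rcons G' u) s1 by apply: agree_rcons => //; apply: agree_ext F1.
have e1 : ext G (rcons G' u) by rewrite -cats1; apply: ext_trans e (ext_cat _ _).
have V : runs X (rcons G' u) (VAR d) u 1.
  by have := @runs_var (rcons G' u) d; rewrite size_rcons ltnS leqnn nth_rcons ltnn eqxx; apply.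
have [t2 [s2 [E2 le2 V2 F2]]] := Hf _ _ e1 V _ _ (ext_refl _) A1.
rewrite size_rcons in E2 V2 F2.
exists (t1 + (t2 + 2)), (update s2 d (s2 d.+1)); split.
- apply: ExecSeq E1 _; apply: ExecSeq E2 _.
  exact: (ExecAssign d (EVar d.+1) s2).
- have h2 : 2 <= X ^ 1 by rewrite expn1.
  by rewrite addnA; apply: leq_powW (leq_pow_add (leq_pow_add le1 le2) h2) _; lia.
- by rewrite updateE V2.
- move=> i hi; rewrite update_neq; last by rewrite neq_ltn hi.
  by rewrite F2 ?F1 // ltnW.
Qed.

(** The body is checked only at accumulators that come from a prefix [vs1] of [vs], so invariants of
    the intermediate values can be used there. *)
Lemma runs_fold A B (eA : A -> tree) (eB : B -> tree) (f : B -> A -> B) vs (b0 : B)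
    (G : seq tree) l i body p k m r :
  runs X G l (enc_seq eA vs) k -> runs X G i (eB b0) m -> size vs <= X ^ p ->
  (forall G' x y (v : A) (vs1 vs2 : seq A), ext G G' -> vs = vs1 ++ v :: vs2 ->
     runs X G' x (eB (foldl f b0 vs1)) 1 -> runs X G' y (eA v) 1 ->
     runs X G' (body x y) (eB (f (foldl f b0 vs1) v)) r) ->
  runs X G (FOLD l i body) (eB (foldl f b0 vs)) (k + m + p + r + 12).
Proof.
move=> Hl Hi hp Hb G' s e Ag; set d := size _.
have [t1 [s1 [E1 le1 V1 F1]]] := Hl _ _ e Ag.
have A1 : agree (rcons G' (enc_seq eA vs)) s1.
  by apply: agree_rcons => //; apply: agree_ext F1.
have e1 : ext G (rcons G' (enc_seq eA vs)).
  by rewrite -cats1; apply: ext_trans e (ext_cat _ _).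
have [t2 [s2 [E2 le2 V2 F2]]] := Hi _ _ e1 A1.
rewrite size_rcons in E2 V2 F2.
rewrite /FOLD -/d; set W := (While _ _).
(* Loop invariant: [vs1] is processed and [vs2] remains. A round costs the body plus 2 + 3 + 3 + 2 =
   10 steps for the test and the three assignments; the final 2 is the failing test. *)
have loop vs1 vs2 s3 : vs = vs1 ++ vs2 -> s3 d = enc_seq eA vs2 ->
    s3 d.+1 = eB (foldl f b0 vs1) -> (forall j, j < d -> s3 j = s j) ->
    exists t4 s4, [/\ exec W s3 t4 s4, t4 <= size vs2 * (X ^ r + 10) + 2,
      s4 d.+1 = eB (foldl f b0 vs) & forall j, j < d -> s4 j = s j].
  elim: vs2 vs1 s3 => [|v vs2 IH] vs1 s3 dvs Vd Va F3.
    exists 2, s3; split=> //; first exact: (ExecWhileFalse (e := EVar d)).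
    by rewrite dvs cats0.
  pose s4 := update s3 d.+2 (eA v).
  pose s5 := update s4 d (enc_seq eA vs2).
  have N1 : d != d.+2 by lia.
  have N2 : d.+1 != d.+2 by lia.
  have N3 : d.+2 != d by lia.
  have N4 : d.+1 != d by lia.
  have X4 : exec (Assign d.+2 (EHd (EVar d))) s3 3 s4.
    by have := ExecAssign d.+2 (EHd (EVar d)) s3; rewrite /= Vd.
  have X5 : exec (Assign d (ETl (EVar d))) s4 3 s5.
    have Vd4 : s4 d = enc_seq eA (v :: vs2) by rewrite /s4 (update_neq _ _ N1).
    by have := ExecAssign d (ETl (EVar d)) s4; rewrite /= Vd4.
  pose H := G' ++ [:: enc_seq eA vs2; eB (foldl f b0 vs1); eA v].
  have szH : size H = d.+3 by rewrite size_cat /= addn3.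
  have AH : agree H s5.
    move=> j; rewrite szH !ltnS leq_eqVlt => /orP[/eqP ->|].
      rewrite /s5 (update_neq _ _ N3) /s4 updateE nth_cat -/d ltnNge leqW //=.
      by rewrite (_ : d.+2 - d = 2) //; lia.
    rewrite ltnS leq_eqVlt => /orP[/eqP ->|].
      rewrite /s5 (update_neq _ _ N4) /s4 (update_neq _ _ N2) Va nth_cat -/d ltnNge leqW //=.
      by rewrite (_ : d.+1 - d = 1) //; lia.
    rewrite ltnS leq_eqVlt => /orP[/eqP ->|hj].
      by rewrite /s5 updateE nth_cat ltnn subnn.
    rewrite /s5 update_neq /s4; last lia.
    by rewrite update_neq ?F3 ?Ag ?nth_cat ?hj //; lia.
  have eH : ext G' H by apply: ext_cat.
  have Rx : runs X H (VAR d.+1) (eB (foldl f b0 vs1)) 1.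
    have := @runs_var H d.+1 (ltac:(by rewrite szH)).
    by rewrite nth_cat -/d ltnNge leqnSn /= (_ : d.+1 - d = 1) //; lia.
  have Ry : runs X H (VAR d.+2) (eA v) 1.
    have := @runs_var H d.+2 (ltac:(by rewrite szH)).
    by rewrite nth_cat -/d ltnNge leqW //= (_ : d.+2 - d = 2) //; lia.
  have [t6 [s6 [E6 le6 V6 F6]]] :=
    Hb _ _ _ _ _ _ (ext_trans e eH) dvs Rx Ry _ _ (ext_refl _) AH.
  rewrite szH in E6 V6 F6.
  pose s7 := update s6 d.+1 (eB (f (foldl f b0 vs1) v)).
  have X7 : exec (Assign d.+1 (EVar d.+3)) s6 2 s7.
    by have := ExecAssign d.+1 (EVar d.+3) s6; rewrite /= V6.
  have [||||t8 [s8 [E8 le8 V8 F8]]] := IH (rcons vs1 v) s7.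
  - by rewrite cat_rcons.
  - by rewrite /s7 update_neq ?F6 ?/s5 ?updateE //; lia.
  - by rewrite /s7 updateE foldl_rcons.
  - move=> j hj; rewrite /s7 update_neq ?F6 ?/s5; try lia.
    by rewrite update_neq ?/s4 ?update_neq ?F3 //; lia.
  exists (2 + (3 + (3 + (t6 + 2))) + t8), s8; split=> //.
    apply: (ExecWhileTrue (e := EVar d)) E8; first by rewrite /= Vd.
    by apply: ExecSeq X4 _; apply: ExecSeq X5 _; exact: ExecSeq E6 X7.
  by rewrite /= mulSn; lia.
have [||||t4 [s4 [E4 le4 V4 F4]]] := loop [::] vs s2 => //.
- by rewrite F2.
- by move=> j hj; rewrite F2 ?F1 // ltnW.
exists (t1 + (t2 + (t4 + 2))), (update s4 d (s4 d.+1)); split.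
- apply: ExecSeq E1 _; apply: ExecSeq E2 _; apply: ExecSeq E4 _.
  exact: (ExecAssign d (EVar d.+1) s4).
- have h10 : 10 <= X ^ 4.
    by apply: leq_trans (_ : 2 ^ 4 <= _) => //; rewrite (leq_exp2r 2 _ (isT : 0 < 4)).
  have hr := leq_pow_add (leqnn (X ^ r)) h10.
  have h4 := leq_pow_add (leq_pow_mul hp hr) leq4_powX.
  have h := leq_pow_add (leq_pow_add le1 le2) h4.
  apply: leq_powW (leq_trans _ h) _; first by rewrite -!addnA; lia.
  lia.
- by rewrite updateE.
- by move=> j hj; rewrite update_neq ?F4 //; lia.
Qed.

End Rules.

Arguments runs_nil {X} X2 {G}.

(** Used on entering a binder: all that is known about outer variables is carried over to the larger
    scope. *)
Ltac lift e := match type of e with ext ?G ?G' =>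
  repeat match goal with H : runs _ G _ _ _ |- _ => apply (runs_ext e) in H end end.

(** * Calling a given program on shifted variables *)

Fixpoint ebound (e : expr) : nat :=
  match e with
  | EVar x => x.+1
  | ENil => 0
  | ECons e1 e2 => maxn (ebound e1) (ebound e2)
  | EHd e1 | ETl e1 => ebound e1
  end.

Fixpoint cbound (c : cmd) : nat :=
  match c with
  | Assign x e => maxn x.+1 (ebound e)
  | Seq c1 c2 => maxn (cbound c1) (cbound c2)
  | If e c1 c2 => maxn (ebound e) (maxn (cbound c1) (cbound c2))
  | While e c1 => maxn (ebound e) (cbound c1)
  end.

Fixpoint eshift (d : nat) (e : expr) : expr :=
  match e with
  | EVar x => EVar (d + x)
  | ENil => ENil
  | ECons e1 e2 => ECons (eshift d e1) (eshift d e2)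
  | EHd e1 => EHd (eshift d e1)
  | ETl e1 => ETl (eshift d e1)
  end.

Fixpoint cshift (d : nat) (c : cmd) : cmd :=
  match c with
  | Assign x e => Assign (d + x) (eshift d e)
  | Seq c1 c2 => Seq (cshift d c1) (cshift d c2)
  | If e c1 c2 => If (eshift d e) (cshift d c1) (cshift d c2)
  | While e c1 => While (eshift d e) (cshift d c1)
  end.

Lemma ecost_shift d e : ecost (eshift d e) = ecost e.
Proof. by elim: e => //= [e1 -> e2 ->|e ->|e ->]. Qed.

Lemma eval_shift M d e s S : ebound e <= M ->
  (forall i, i < M -> S (d + i) = s i) -> eval S (eshift d e) = eval s e.
Proof.
move=> + H; elim: e => //= [e1 IH1 e2 IH2|e IH /IH -> //|e IH /IH -> //].

by rewrite geq_max => /andP[/IH1 -> /IH2 ->].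
Qed.

(** The shifted program simulates the original one on the block starting at [d]. Agreement on the
    first [M] variables suffices, as the program mentions none beyond them. *)
Lemma exec_shift M d c s t s' : exec c s t s' -> cbound c <= M ->
  forall S, (forall i, i < M -> S (d + i) = s i) ->
  exists S', [/\ exec (cshift d c) S t S',
    forall i, i < M -> S' (d + i) = s' i & forall j, j < d -> S' j = S j].
Proof.
elim=> {c s t s'} /=.
- move=> x e s; rewrite geq_max => /andP[hx he] S H.
  exists (update S (d + x) (eval s e)); split.
  + by rewrite -(ecost_shift d) -(eval_shift he H); apply: ExecAssign.
  + by move=> i hi; rewrite /update eqn_add2l H.
  + by move=> j hj; rewrite update_neq //; lia.
- move=> c1 c2 s s1 s2 t1 t2 _ IH1 _ IH2; rewrite geq_max => /andP[h1 h2] S H.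
  have [S1 [E1 H1 F1]] := IH1 h1 _ H.
  have [S2 [E2 H2 F2]] := IH2 h2 _ H1.
  by exists S2; split=> //; [apply: ExecSeq E1 E2 | move=> j hj; rewrite F2 ?F1].
- move=> e c1 c2 s s1 t He _ IH; rewrite !geq_max => /and3P[he h1 h2] S H.
  have [S1 [E1 H1 F1]] := IH h1 _ H.
  exists S1; split=> //; rewrite -(ecost_shift d).
  by apply: ExecIfTrue => //; rewrite (eval_shift he H).
- move=> e c1 c2 s s1 t He _ IH; rewrite !geq_max => /and3P[he h1 h2] S H.
  have [S1 [E1 H1 F1]] := IH h2 _ H.
  exists S1; split=> //; rewrite -(ecost_shift d).
  by apply: ExecIfFalse => //; rewrite (eval_shift he H).
- move=> e c s He; rewrite !geq_max => /andP[he h] S H.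
  exists S; split=> //; rewrite -(ecost_shift d).
  by apply: ExecWhileFalse; rewrite (eval_shift he H).
- move=> e c s s1 s2 t1 t2 He _ IH1 _ IH2 hc; move: (hc).
  rewrite !geq_max => /andP[he h] S H.
  have [S1 [E1 H1 F1]] := IH1 h _ H.
  have [S2 [E2 H2 F2]] := IH2 hc _ H1.
  exists S2; split=> //; last by move=> j hj; rewrite F2 ?F1.
  by rewrite -(ecost_shift d); apply: ExecWhileTrue E1 E2; rewrite (eval_shift he H).
Qed.

(** The variable [d] keeps its value, being the argument of the call. The base case is a
    self-assignment because the language has no skip. *)
Fixpoint clear (d m : nat) : cmd :=
  if m is m'.+1 then Seq (clear d m') (Assign (d + m) ENil) else Assign d (EVar d).

Lemma exec_clear d m s : exists s', [/\ exec (clear d m) s (m.+1 * 2) s',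
  s' d = s d, forall i, 0 < i <= m -> s' (d + i) = Leaf &
  forall j, j < d -> s' j = s j].
Proof.
elim: m => [|m [s1 [E1 V1 Z1 F1]]] /=.
  exists (update s d (s d)); split; rewrite ?updateE //.
  - exact: (ExecAssign d (EVar d) s).
  - by move=> i; lia.
  - by move=> j hj; rewrite update_neq //; lia.
exists (update s1 (d + m.+1) Leaf); split.
- rewrite (_ : m.+2 * 2 = m.+1 * 2 + 2); last lia.
  by apply: ExecSeq E1 _; apply: (ExecAssign (d + m.+1) ENil).
- by rewrite update_neq //; lia.
- move=> i hi; rewrite /update eqn_add2l; case: eqP => // ne; apply: Z1; lia.
- by move=> j hj; rewrite update_neq ?F1 //; lia.
Qed.

(* The variables of [p] live from [d] on.  They have to be reset, as an earlier
   call may have left values there. *)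
Definition CALL (p : cmd) (a : tm) : tm := fun d =>
  Seq (a d) (Seq (clear d (cbound p)) (cshift d p)).

Lemma runs_call X (X2 : 1 < X) (p : cmd) (G : seq tree) (a : tm) v t s' k m :
  runs X G a v k -> exec p (init v) t s' -> t <= X ^ m ->
  runs X G (CALL p a) (s' 0) (k + (cbound p).+1 * 2 + m).+2.
Proof.
move=> Ha E hm G' s e A; set d := size _.
have [t1 [s1 [E1 le1 V1 F1]]] := Ha _ _ e A.
have [s2 [E2 V2 Z2 F2]] := exec_clear d (cbound p) s1.
(* The argument in [d] together with the cleared variables [d + 1], ..., [d + cbound p] forms a
   block of this length that looks like [init v]. *)
pose M := (cbound p).+1.
have [|i|S' [E3 H3 F3]] := @exec_shift M d p (init v) t s' E _ s2.
- exact: leqnSn.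
- case: i => [|i] hi; first by rewrite addn0 V2 V1.
  by rewrite Z2 // /init update_neq.
exists (t1 + (M * 2 + t)), S'; split.
- by apply: ExecSeq E1 _; apply: ExecSeq E2 E3.
- rewrite addnA; apply: leq_powW (leq_pow_add X2 (leq_pow_add X2 le1 (leq_powX X2 _)) hm) _ => //.
- by rewrite -(H3 0) ?addn0.
- by move=> j hj; rewrite F3 ?F2 ?F1.
Qed.

(** * Enumerations and decoding of guesses *)

Lemma mem_foldl (A B : eqType) (f : seq B -> A -> seq B) (p : A -> B -> bool) s b0 y :
  (forall b a, (y \in f b a) = (y \in b) || p a y) ->
  (y \in foldl f b0 s) = (y \in b0) || has (p^~ y) s.
Proof.
move=> Hf; elim: s b0 => [|a s IH] b0 /=; first by rewrite orbF.
by rewrite IH Hf orbA.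
Qed.

Lemma size_foldl A B (f : seq B -> A -> seq B) k s b0 :
  (forall b a, size (f b a) <= size b + k) ->
  size (foldl f b0 s) <= size b0 + size s * k.
Proof.
move=> Hf; elim: s b0 => [|a s IH] b0 /=; first by rewrite addn0.
by apply: leq_trans (IH _) _; rewrite mulSn addnA leq_add2r.
Qed.

Lemma foldl_consE A B (f : A -> B) s b0 :
  foldl (fun acc a => f a :: acc) b0 s = rev (map f s) ++ b0.
Proof. by elim: s b0 => //= a s IH b0; rewrite IH rev_cons cat_rcons. Qed.

(** Here and below, lists are built by left folds with an accumulator, the shape that [FOLD]
    computes literally. *)
Definition extb (vs : seq (seq bool)) : seq (seq bool) :=
  foldl (fun acc w => [:: true :: w, false :: w & acc]) [::] vs.

Definition allb k : seq (seq bool) := iter k extb [:: [::]].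

Lemma size_extb vs : size (extb vs) = 2 * size vs.
Proof.
suff H b0 : size (foldl (fun acc w => [:: true :: w, false :: w & acc]) b0 vs) =
    size b0 + 2 * size vs by rewrite /extb H.
elim: vs b0 => [|w vs IH] b0 /=; first by rewrite addn0.
by rewrite IH /=; lia.
Qed.

Lemma size_allb k : size (allb k) = 2 ^ k.
Proof. by elim: k => //= k IH; rewrite size_extb IH expnS. Qed.

Lemma mem_allb k w : (w \in allb k) = (size w == k).
Proof.
elim: k w => [|k IH] w /=; first by rewrite inE; case: w.
rewrite (mem_foldl (p := fun w v => (v == true :: w) || (v == false :: w))); last first.
  by move=> b a; rewrite !inE orbA orbC.
rewrite in_nil /=; apply/hasP/idP => [[v]|].
  by rewrite IH => /eqP <- /orP[] /eqP ->.
case: w => [|x w] //=; rewrite eqSS => hw; exists w; first by rewrite IH.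
by case: x; rewrite eqxx ?orbT.
Qed.

Definition iotar n : seq nat := iter n (fun s => size s :: s) [::].

Lemma size_iotar n : size (iotar n) = n.
Proof. by elim: n => //= n ->. Qed.

Lemma mem_iotar n i : (i \in iotar n) = (i < n).
Proof.
elim: n => [|n IH]; first by rewrite in_nil.
by rewrite /= inE size_iotar IH ltnS [RHS]leq_eqVlt.
Qed.

Lemma uniq_iotar n : uniq (iotar n).
Proof. by elim: n => //= n ->; rewrite mem_iotar size_iotar ltnn. Qed.

(** The pairs (group, bit); the variable [x] of the formula is placed at the [x]-th entry. *)
Definition positions b : seq (nat * nat) :=
  foldl (fun acc j => foldl (fun acc t => (j, t) :: acc) acc (iotar b)) [::]
    (iotar (2 ^ b)).

Lemma positionsE b :
  positions b = rev [seq (j, t) | j <- iotar (2 ^ b), t <- iotar b].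
Proof.
rewrite /positions -[RHS]cats0; elim: (iotar (2 ^ b)) [::] => //= j s IH b0.
by rewrite IH foldl_consE rev_cat catA.
Qed.

Lemma size_positions b : size (positions b) = 2 ^ b * b.
Proof. by rewrite positionsE size_rev size_allpairs !size_iotar. Qed.

Lemma mem_positions b e : (e \in positions b) = (e.1 < 2 ^ b) && (e.2 < b).
Proof.
rewrite positionsE mem_rev; case: e => j t /=.
apply/allpairsP/andP => [[[j' t'] /= [+ + [-> ->]]]|[hj ht]].
  by rewrite !mem_iotar.
by exists (j, t); rewrite !mem_iotar.
Qed.

Lemma uniq_positions b : uniq (positions b).
Proof.
by rewrite positionsE rev_uniq allpairs_uniq ?uniq_iotar // => -[? ?] [? ?].
Qed.

(* Bits over the list [vals] of all the labels: [false] emits the first label,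
   [true] drops it.  Every multiset of labels is the output of such a word. *)
Definition decode_step (st : seq (seq bool) * seq (seq bool)) (x : bool) :=
  if x then (behead st.1, st.2) else (st.1, head [::] st.1 :: st.2).

Definition decode vals (g : seq bool) : seq (seq bool) :=
  (foldl decode_step (vals, [::]) g).2.

(** By induction on [vals]: emit the first label as often as it occurs in [ws], drop it, and go on
    with the other elements of [ws]. This takes one bit per element of [ws] and one per label. *)
Lemma decode_complete vals ws : {subset ws <= vals} ->
  exists2 g, size g = size ws + size vals & perm_eq (decode vals g) ws.
Proof.
rewrite /decode => H.
suff: exists2 g, size g = size ws + size vals &
    forall out, perm_eq (foldl decode_step (vals, out) g).2 (ws ++ out).
  by move=> [g hg /(_ [::])]; rewrite cats0; exists g.
elim: vals ws H => [|v vals IH] ws H.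
  exists [::]; case: ws H => [|w ws /(_ w (mem_head _ _))] //.
have [|g hg Hg] := IH [seq w <- ws | w != v].
  by move=> w; rewrite mem_filter => /andP[/negbTE nv /H]; rewrite inE nv.
exists (nseq (count_mem v ws) false ++ true :: g).
  rewrite size_cat size_nseq /= hg addnS size_filter addnA.
  by rewrite (count_predC (pred1 v)) addnS.
have emit k out : foldl decode_step (v :: vals, out) (nseq k false) =
    (v :: vals, nseq k v ++ out).
  elim: k out => //= k IHk out; rewrite IHk; congr pair.
  by elim: k {IHk} => //= k ->.
move=> out; rewrite foldl_cat emit /=; apply: perm_trans (Hg _) _.
have -> : nseq (count_mem v ws) v = filter (pred1 v) ws.
  by symmetry; rewrite -size_filter; apply/all_pred1P/filter_all.
by rewrite catA perm_cat2r perm_catC; apply/permPl/(perm_filterC (pred1 v)).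
Qed.

(** * The hitting set instance and its soundness *)

Section Reduction.
Variables (q : nat) (labs : seq (seq bool)).
Implicit Types (o r : nat) (e u : nat * nat) (sg : bool) (acc : seq (nat * nat)).

Definition label r t : bool := nth false (nth [::] labs r) t.

(** The set of the literal with position [e] and sign [sg], placed in the class at offset [o] and
    added to [acc]. *)
Definition cells o e sg acc : seq (nat * nat) :=
  foldl (fun acc r => if label r e.2 == sg then (o + r, o + e.1) :: acc else acc)
    acc (iotar q).

Definition is_cell o e sg u : Prop :=
  exists r, [/\ r < q, label r e.2 = sg & u = (o + r, o + e.1)].

Lemma mem_cells o e sg acc u :
  u \in cells o e sg acc <-> u \in acc \/ is_cell o e sg u.
Proof.
rewrite /cells (mem_foldl
  (p := fun r u => (label r e.2 == sg) && (u == (o + r, o + e.1)))); last first.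
  by move=> a r; case: ifP => _; rewrite ?orbF // inE orbC.
split=> [/orP[->|/hasP[r]]|[->//|[r [hr hl hu]]]]; first by left.
- by rewrite mem_iotar => hr /andP[/eqP hl /eqP hu]; right; exists r.
- by apply/orP; right; apply/hasP; exists r; rewrite ?mem_iotar // hl hu !eqxx.
Qed.

Lemma size_cells o e sg acc : size (cells o e sg acc) <= size acc + q.
Proof.
have := @size_foldl _ _ (fun acc r =>
  if label r e.2 == sg then (o + r, o + e.1) :: acc else acc) 1 (iotar q) acc.
rewrite size_iotar muln1; apply => b r; case: ifP => _ /=; lia.
Qed.

Variable pos : seq (nat * nat).

(* The first component is the offset [i * q] of the class of the [i]-th literal. *)
Definition clause_step (st : nat * seq (nat * nat)) (l : nat * bool) :=
  (st.1 + q, cells st.1 (nth (0, 0) pos l.1) l.2 st.2).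

Definition clause_set (C : seq (nat * bool)) : seq (nat * nat) :=
  (foldl clause_step (0, [::]) C).2.

Lemma mem_clause_set C u : u \in clause_set C <->
  exists i, i < size C /\
    let l := nth (0, false) C i in is_cell (i * q) (nth (0, 0) pos l.1) l.2 u.
Proof.
rewrite /clause_set.
suff H o acc : u \in (foldl clause_step (o, acc) C).2 <-> u \in acc \/
    exists i, i < size C /\
    let l := nth (0, false) C i in is_cell (o + i * q) (nth (0, 0) pos l.1) l.2 u.
  rewrite H in_nil; split=> [[]//|]; by right.
elim: C o acc => [|l C IH] o acc /=; first by split=> [|[]//[i []]//]; left.
rewrite IH mem_cells; split=> [[[]|[i [hi hu]]]|[|[[|i] [hi hu]]]]; auto.
- by move=> hu; right; exists 0; rewrite addn0.
- by right; exists i.+1; rewrite ltnS; split=> //=; rewrite mulSn addnA.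
- by left; right; rewrite addn0 in hu.
- by right; exists i; split=> //; rewrite /= mulSn addnA in hu.
Qed.

Lemma size_clause_set C : size (clause_set C) <= size C * q.
Proof.
rewrite /clause_set.
suff H o acc : size (foldl clause_step (o, acc) C).2 <= size acc + size C * q.
  exact: H.
elim: C o acc => [|l C IH] o acc /=; first by rewrite addn0.
apply: leq_trans (IH _ _) _; rewrite /clause_step /=.
by have := size_cells o (nth (0, 0) pos l.1) l.2 acc; rewrite mulSn; lia.
Qed.

Definition offsets : seq nat := [:: 0; q; q + q].

(** Over all ordered pairs of offsets, these sets express the implications between the copies of a
    variable in both directions. *)
Definition pair_set e c d : seq (nat * nat) := cells c e true (cells d e false [::]).

Definition pair_sets : seq (seq (nat * nat)) :=
  foldl (fun out e => foldl (fun out c => foldl (fun out d =>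
    pair_set e c d :: out) out offsets) out offsets) [::] pos.

Definition hs_lists (cls : seq (seq (nat * bool))) : seq (seq (nat * nat)) :=
  foldl (fun out C => clause_set C :: out) pair_sets cls.

Lemma mem_hs_lists cls S : S \in hs_lists cls <->
  (exists2 C, C \in cls & S = clause_set C) \/
  exists e c d, [/\ e \in pos, c \in offsets, d \in offsets & S = pair_set e c d].
Proof.
rewrite /hs_lists foldl_consE mem_cat mem_rev /pair_sets.
rewrite (mem_foldl (p := fun e S => has (fun c => has (fun d =>
  S == pair_set e c d) offsets) offsets)); last first.
  move=> out e; rewrite (mem_foldl
    (p := fun c S => has (fun d => S == pair_set e c d) offsets)) // => {}out c.
  rewrite (mem_foldl (p := fun d S => S == pair_set e c d)) // => {}out d.
  by rewrite inE orbC.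
split=> [/orP[/mapP[C hC ->]|/hasP[e he /hasP[c hc /hasP[d hd /eqP ->]]]]|].
- by left; exists C.
- by right; exists e, c, d.
case=> [[C hC ->]|[e [c [d [he hc hd ->]]]]]; apply/orP.
- by left; apply/mapP; exists C.
- right; apply/hasP; exists e => //; apply/hasP; exists c => //.
  by apply/hasP; exists d.
Qed.

(** The 9 counts the ordered pairs of the three offsets. *)
Lemma size_hs_lists cls : size (hs_lists cls) = size cls + size pos * 9.
Proof.
rewrite /hs_lists foldl_consE size_cat size_rev size_map; congr (_ + _).
suff H out : size (foldl (fun out e => foldl (fun out c => foldl (fun out d =>
    pair_set e c d :: out) out offsets) out offsets) out pos) =
    size out + size pos * 9 by rewrite /pair_sets H.
elim: pos out => [|e s IH] out; first by rewrite /= addn0.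
by rewrite /= IH /=; lia.
Qed.

Lemma is_cell_bound o e sg u : o \in offsets -> e.1 < q -> is_cell o e sg u ->
  u.1 < 3 * q /\ u.2 < 3 * q.
Proof.
rewrite !inE => ho he [r [hr _ ->]] /=.
by case/or3P: ho => /eqP ->; split; lia.
Qed.

Lemma offsetP i : i < 3 -> i * q \in offsets.
Proof.
by case: i => [|[|[|i]]] // _; rewrite !inE ?mul1n ?mul2n -?addnn eqxx ?orbT.
Qed.

Lemma offset_inj o o' r r' : o \in offsets -> o' \in offsets -> r < q -> r' < q ->
  o + r = o' + r' -> o = o' /\ r = r'.
Proof.
rewrite !inE => ho ho' hr hr'.
by case/or3P: ho => /eqP ->; case/or3P: ho' => /eqP ->; lia.
Qed.

Hypothesis pos_lt : forall e, e \in pos -> e.1 < q.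

Definition clause_ok (C : seq (nat * bool)) : Prop :=
  size C <= 3 /\ forall l, l \in C -> l.1 < size pos.

Lemma clause_ok_nth C i : clause_ok C -> i < size C ->
  let l := nth (0, false) C i in
  [/\ l \in C, i * q \in offsets & nth (0, 0) pos l.1 \in pos].
Proof.
move=> [h3 hC] hi; have hl := mem_nth (0, false) hi.
split=> //; last exact/mem_nth/hC.
by apply: offsetP; apply: leq_trans hi h3.
Qed.

Variable cls : seq (seq (nat * bool)).
Hypothesis cls_ok : forall C, C \in cls -> clause_ok C.

Lemma hs_lists_bound S u : S \in hs_lists cls -> u \in S ->
  u.1 < 3 * q /\ u.2 < 3 * q.
Proof.
move=> /mem_hs_lists[[C hC ->]|[e [c [d [he hc hd ->]]]]].
  move=> /mem_clause_set[i [hi hu]].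
  have [_ ho hp] := clause_ok_nth (cls_ok hC) hi.
  by apply: is_cell_bound hu => //; apply: pos_lt.
move=> /mem_cells[/mem_cells[]//|]; by apply: is_cell_bound => //; apply: pos_lt.
Qed.

(** The row determines the class. In a clause set the class determines the literal and thereby the
    column; in a pair set the group is fixed, so the class alone gives the column. *)
Lemma hs_lists_thin S u w : S \in hs_lists cls -> u \in S -> w \in S ->
  u.1 = w.1 -> u = w.
Proof.
move=> /mem_hs_lists[[C hC ->]|[e [c [d [he hc hd ->]]]]].
  move=> /mem_clause_set[i [hi [r [hr _ ->]]]] /mem_clause_set[j [hj [r' [hr' _ ->]]]] /=.
  have [_ ho _] := clause_ok_nth (cls_ok hC) hi.
  have [_ ho' _] := clause_ok_nth (cls_ok hC) hj.
  (* Equal offsets [i * q = j * q] give [i = j], since [r < q] makes [q] positive. *)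
  move=> E; have [Eo Er] := offset_inj ho ho' hr hr' E.
  have {Eo}-> // : i = j.
    by move/eqP: Eo; rewrite eqn_pmul2r; [move/eqP | lia].
  by rewrite Er.
move=> hu hw.
have P v : v \in pair_set e c d ->
    exists o r, [/\ o \in offsets, r < q & v = (o + r, o + e.1)].
  case/mem_cells => [/mem_cells[]//|] [r [hr _ ->]]; [by exists d, r | by exists c, r].
have [o [r [ho hr ->]]] := P u hu; have [o' [r' [ho' hr' ->]]] := P w hw.
by move=> /= E; have [-> ->] := offset_inj ho ho' hr hr' E.
Qed.

Definition hit (rho : nat -> nat) (S : seq (nat * nat)) : Prop :=
  exists2 i, i < 3 * q & (i, rho i) \in S.

Section Soundness.
Variable rho : nat -> nat.
Hypothesis rho_hit : forall S, S \in hs_lists cls -> hit rho S.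
Hypothesis pos_onto : forall j, j < q -> exists t, (j, t) \in pos.

(** In the class at offset [o], the literal at [e] with sign [sg] is hit by [rho]. *)
Let T o e sg := exists2 i, i < 3 * q & is_cell o e sg (i, rho i).

Lemma T_pair e c d : e \in pos -> c \in offsets -> d \in offsets ->
  T c e true \/ T d e false.
Proof.
move=> he hc hd; have [|i hi] := rho_hit (S := pair_set e c d).
  by apply/mem_hs_lists; right; exists e, c, d.
by move=> /mem_cells[/mem_cells[]//|] h; [right | left]; exists i.
Qed.

(* Every column is hit, so rho is onto and hence injective. *)
Lemma rho_inj i j : i < 3 * q -> j < 3 * q -> rho i = rho j -> i = j.
Proof.
move=> hi hj E.
have U : uniq (map rho (iota 0 (3 * q))).
  apply: leq_size_uniq (iota_uniq 0 (3 * q)) _ _; last by rewrite size_map.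
  move=> k; rewrite mem_iota /= add0n => hk.
  have q0 : 0 < q by lia.
  have hd : (k %/ q) * q \in offsets by apply: offsetP; rewrite ltn_divLR // mulnC.
  have [t ht] := pos_onto (ltn_pmod k q0).
  (* With both offsets equal to that of the class of [k], either literal has all its cells in column
     [k]. *)
  apply/mapP; case: (T_pair ht hd hd) => -[m hm [r [_ _ [_ Em]]]];
    exists m; rewrite ?mem_iota // Em [LHS](divn_eq k q) //.
have := nth_uniq 0 _ _ U; rewrite size_map size_iota => /(_ i j hi hj).
rewrite !(nth_map 0) ?size_iota // !nth_iota // !add0n E eqxx.
by move=> /esym/eqP.
Qed.

(** The two hit cells share a column, hence by injectivity a row, whose label has only one bit at
    that position. *)
Lemma T_excl o e : o \in offsets -> T o e true -> T o e false -> False.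
Proof.
move=> ho [i hi [r [hr lr [Ei Ri]]]] [j hj [r' [hr' lr' [Ej Rj]]]].
have E : i = j by apply: rho_inj; rewrite // Ri Rj.
have Er : r = r' by lia.
by move: lr lr'; rewrite Er => ->.
Qed.

(** The assignment is read off in the class at offset 0. A clause set is hit through one of its
    literals in that literal's own class, and the pair sets together with [T_excl] transfer its
    value to offset 0. *)
Lemma hs_lists_sound : exists a : nat -> bool,
  forall C, C \in cls -> exists2 l, l \in C & a l.1 = l.2.
Proof.
have o0 : 0 \in offsets by rewrite inE eqxx.
pose a x := [exists i : 'I_(3 * q), let e := nth (0, 0) pos x in
  has (fun r => label r e.2 && ((i : nat, rho i) == (0 + r, 0 + e.1))) (iota 0 q)].
have aP x : reflect (T 0 (nth (0, 0) pos x) true) (a x).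
  apply: (iffP existsP) => [[i /hasP[r]]|[i hi [r [hr lr E]]]].
    rewrite mem_iota => /andP[_ hr] /andP[lr /eqP E].
    by exists i => //; exists r.
  exists (Ordinal hi); apply/hasP; exists r; first by rewrite mem_iota.
  by rewrite lr -E eqxx.
exists a => C hC; have [|i hi] := rho_hit (S := clause_set C).
  by apply/mem_hs_lists; left; exists C.
move=> /mem_clause_set[k [hk hu]].
have [hl ho hp] := clause_ok_nth (cls_ok hC) hk.
set l := nth _ _ k in hl hp hu *; exists l => //.
have hT : T (k * q) (nth (0, 0) pos l.1) l.2 by exists i.
move: hT; case: l.2 => hT; apply/aP.
- by case: (T_pair hp o0 ho) => // /(T_excl ho hT).
- move=> h0; case: (T_pair hp ho o0) => h1; first exact: T_excl ho h1 hT.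
  exact: T_excl o0 h0 h1.
Qed.

End Soundness.
End Reduction.

(* The guess lists the labels [word j] of the groups in some order [Is], and [rho]
   sends the [r]-th row of a class to the group [Is_r] whose label it carries. *)
Lemma hs_lists_complete b (cls : seq (seq (nat * bool))) (a : nat -> bool) :
  let q := 2 ^ b in
  (forall C, C \in cls -> clause_ok (positions b) C) ->
  (forall C, C \in cls -> exists2 l, l \in C & a l.1 = l.2) ->
  exists2 g, size g = 2 * q & exists2 rho,
    (forall i, i < 3 * q -> rho i < 3 * q) &
    forall S, S \in hs_lists q (decode (allb b) g) (positions b) cls -> hit q rho S.
Proof.
move=> q cls_ok sat.
(* The entries of [positions b] are distinct, so [index] recovers the variable placed at [e]. *)
pose A e := a (index e (positions b)).
pose word j := [seq A (j, t) | t <- iota 0 b].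
have [|g] := @decode_complete (allb b) (map word (iota 0 q)).
  by move=> w /mapP[j _ ->]; rewrite mem_allb size_map size_iota.
rewrite size_map size_iota size_allb => hg.
(* The decoded labels are the words of the groups up to order; [Is] records which group supplies the
   label of each row. *)
set labs := decode _ _ => /(perm_iotaP [::])[Is].
rewrite size_map size_iota => hIs dlabs.
exists g; first by rewrite hg mul2n addnn.
have sIs : size Is = q by rewrite (perm_size hIs) size_iota.
have memIs j : (j \in Is) = (j < q) by rewrite (perm_mem hIs) mem_iota.
(* The class of the row is kept, and the same permutation [Is] acts inside each class. *)
pose rho i := (i %/ q) * q + nth 0 Is (i %% q).
have q0 : 0 < q by rewrite expn_gt0.
have nth_lt r : r < q -> nth 0 Is r < q by move=> hr; rewrite -memIs mem_nth ?sIs.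
exists rho => [i hi|].
  have : i %/ q < 3 by rewrite ltn_divLR.
  have := nth_lt _ (ltn_pmod i q0); rewrite /rho.
  by case: (i %/ q) => [|[|[|]]] // ; lia.
have cell_hit o e : o \in offsets q -> e \in positions b ->
    exists2 i, i < 3 * q & is_cell q labs o e (A e) (i, rho i).
  case: e => j t ho; rewrite mem_positions /= => /andP[hj ht].
  have hr : index j Is < q by rewrite -sIs index_mem memIs.
  exists (o + index j Is).
    by move: ho; rewrite !inE => /or3P[] /eqP ->; lia.
  exists (index j Is); split=> //=.
    rewrite /label dlabs (nth_map 0) ?sIs // nth_index ?memIs //.
    by rewrite (nth_map 0) ?size_iota // nth_iota // add0n
      (nth_map 0) ?size_iota // nth_iota.
  congr pair; rewrite /rho.
  have [c ->] : exists c, o = c * q.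
    move: ho; rewrite !inE => /or3P[] /eqP ->; [exists 0 | exists 1 | exists 2]; lia.
  by rewrite divnMDl // modnMDl divn_small // modn_small // addn0 nth_index ?memIs.
move=> S /mem_hs_lists[[C hC ->]|[e [c [d [he hc hd ->]]]]].
  have [l hl al] := sat C hC.
  have hi : index l C < size C by rewrite index_mem.
  have [_ ho hp] := clause_ok_nth q (cls_ok C hC) hi.
  have [m hm hcell] := cell_hit _ _ ho hp.
  exists m => //; apply/mem_clause_set; exists (index l C); split=> //=.
  move: hp hcell; rewrite nth_index // /A index_uniq ?uniq_positions ?al //.
  by case: (cls_ok C hC) => _; apply.
(* All three classes realise the same assignment, so the set is hit in class [c] if the bit at [e]
   is true and in class [d] if it is false. *)
case dA: (A e).
  have [m hm hcell] := cell_hit _ _ hc he; rewrite dA in hcell.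
  by exists m => //; apply/mem_cells; right.
have [m hm hcell] := cell_hit _ _ hd he; rewrite dA in hcell.
by exists m => //; apply/mem_cells; left; apply/mem_cells; right.
Qed.

(** * The program of the reduction *)

Definition enc_bits : seq bool -> tree := enc_seq enc_bool.
Definition enc_pair (e : nat * nat) : tree := Node (enc_nat e.1) (enc_nat e.2).
Definition enc_lit (l : nat * bool) : tree := Node (enc_nat l.1) (enc_bool l.2).

Definition TRUE : tm := CONS NIL NIL.
Definition EQB (a b : tm) : tm := IF a (IF b TRUE NIL) (IF b NIL TRUE).
Definition ADD (a b : tm) : tm := FOLD a b (fun x _ => CONS NIL x).
Definition LEN (l : tm) : tm := FOLD l NIL (fun x _ => CONS NIL x).
Definition DROP (k l : tm) : tm := FOLD k l (fun x _ => TL x).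
Definition NTH (k l : tm) : tm := HD (DROP k l).
Definition EXT (l : tm) : tm :=
  FOLD l NIL (fun x w => CONS (CONS TRUE w) (CONS (CONS NIL w) x)).
Definition ALLB (k : tm) : tm := FOLD k (CONS NIL NIL) (fun x _ => EXT x).
Definition IOTA (k : tm) : tm := FOLD k NIL (fun x _ => CONS (LEN x) x).
Definition POSITIONS (b : tm) : tm :=
  FOLD (IOTA (LEN (ALLB b))) NIL (fun x j => FOLD (IOTA b) x (fun y t =>
    CONS (CONS j t) y)).
(** The list left after dropping [n] positions serves as the truth value of
    [n < size (positions b)]. *)
Definition SEARCH (n : tm) : tm :=
  FOLD (CONS NIL n) NIL (fun b _ => IF (DROP n (POSITIONS b)) b (CONS NIL b)).
Definition DECODE (vals g : tm) : tm :=
  TL (FOLD g (CONS vals NIL) (fun st x =>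
    IF x (CONS (TL (HD st)) (TL st))
         (CONS (HD st) (CONS (HD (HD st)) (TL st))))).

(** * Correctness and running time of the basic routines *)

Section Specs.
Variables (X : nat) (X2 : 1 < X).
Implicit Types (G : seq tree).

(** A unary number is a list of units, so [FOLD] over a number is a loop with that many rounds. *)
Lemma enc_natE n : enc_nat n = enc_seq (fun _ : unit => Leaf) (nseq n tt).
Proof. by elim: n => //= n <-. Qed.

Lemma runs_iter B (eB : B -> tree) (f : B -> B) n (b0 : B) G l i body p k m r :
  runs X G l (enc_nat n) k -> runs X G i (eB b0) m -> n <= X ^ p ->
  (forall G' x y j, ext G G' -> j < n -> runs X G' x (eB (iter j f b0)) 1 ->
     runs X G' (body x y) (eB (f (iter j f b0))) r) ->
  runs X G (FOLD l i body) (eB (iter n f b0)) (k + m + p + r + 12).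
Proof.
have iterE j : iter j f b0 = foldl (fun b (_ : unit) => f b) b0 (nseq j tt).
  by elim: j b0 => //= j IH b; rewrite -IH -iterSr.
rewrite enc_natE iterE => Hl Hi hp Hb.
apply: runs_fold Hl Hi _ _ => //; first by rewrite size_nseq.
move=> G' x y [] vs1 vs2 e E Rx _.
have E1 : vs1 = nseq (size vs1) tt by elim: (vs1) => //= -[] s <-.
rewrite E1 -iterE in Rx *; apply: Hb e _ Rx.
by move/(congr1 size): E; rewrite size_nseq size_cat /=; lia.
Qed.

Lemma runs_hdN G a u v k : runs X G a (Node u v) k -> runs X G (HD a) u k.+3.
Proof. exact: runs_hd. Qed.

Lemma runs_tlN G a u v k : runs X G a (Node u v) k -> runs X G (TL a) v k.+3.
Proof. exact: runs_tl. Qed.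

(** The head of an empty list evaluates to [Leaf], so the default must be encoded by [Leaf], as
    [false] and [[::]] are but [(0, 0)] is not, or else the list must be nonempty. *)
Lemma runs_hdS A (e : A -> tree) x0 G a s k : e x0 = Leaf \/ 0 < size s ->
  runs X G a (enc_seq e s) k -> runs X G (HD a) (e (head x0 s)) k.+3.
Proof. by case: s => [|x s] h /(runs_hd X2) //=; case: h => // ->. Qed.

Lemma runs_tlS A (e : A -> tree) G a s k :
  runs X G a (enc_seq e s) k -> runs X G (TL a) (enc_seq e (behead s)) k.+3.
Proof. by case: s => [|x s] /(runs_tl X2). Qed.

Lemma runs_true G : runs X G TRUE (enc_bool true) 6.
Proof. exact: (runs_cons X2 (runs_nil X2) (runs_nil X2)). Qed.

Arguments runs_true {G}.

Lemma runs_eqb G a b x y k m : runs X G a (enc_bool x) k -> runs X G b (enc_bool y) m ->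
  runs X G (EQB a b) (enc_bool (x == y)) (k + m + m + 23).
Proof.
move=> Ha Hb; eapply (runs_weak X2).
  apply: (runs_if X2 Ha (m1 := m + 10) (m2 := m + 10)).
    case: x {Ha} => // _; eapply (runs_weak X2).
      apply: (runs_if X2 Hb (m1 := 6) (m2 := 1)); case: y {Hb} => // _;
        [exact: runs_true | exact: runs_nil].
    lia.
  case: x {Ha} => // _; eapply (runs_weak X2).
    apply: (runs_if X2 Hb (m1 := 1) (m2 := 6)); case: y {Hb} => // _;
      [exact: runs_nil | exact: runs_true].
  lia.
lia.
Qed.

Lemma runs_add G a b n m k k' p : runs X G a (enc_nat n) k -> runs X G b (enc_nat m) k' ->
  n <= X ^ p -> runs X G (ADD a b) (enc_nat (n + m)) (k + k' + p + 6 + 12).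
Proof.
move=> Ha Hb hp; have -> : n + m = iter n succn m by elim: (n) => //= j <-.
apply: (runs_iter (f := succn) (eB := enc_nat) Ha Hb hp _) => G' x y j e _ Rx.
exact: (runs_cons X2 (runs_nil X2) Rx).
Qed.

Lemma runs_len A (e : A -> tree) s G a k p : runs X G a (enc_seq e s) k ->
  size s <= X ^ p -> runs X G (LEN a) (enc_nat (size s)) (k + p + 19).
Proof.
move=> Ha hp.
have E t i : foldl (fun j _ => j.+1) i t = i + size t :> nat.
  by elim: t i => [|x t IH] i /=; rewrite ?addn0 // IH addSnnS.
have -> : size s = foldl (fun j (_ : A) => j.+1) 0 s by rewrite E.
eapply (runs_weak X2).
  apply: (runs_fold X2 (f := fun j (_ : A) => j.+1) (eB := enc_nat) (b0 := 0) Ha _ hp _).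
    exact: runs_nil.
  by move=> G' x y v s1 s2 e1 _ Rx _; exact: (runs_cons X2 (runs_nil X2) Rx).
lia.
Qed.

Lemma runs_drop A (e : A -> tree) s n G a b k m p :
  runs X G a (enc_nat n) k -> runs X G b (enc_seq e s) m -> n <= X ^ p ->
  runs X G (DROP a b) (enc_seq e (drop n s)) (k + m + p + 16).
Proof.
move=> Ha Hb hp; have -> : drop n s = iter n behead s.
  elim: (n) => [|j IH]; first by rewrite drop0.
  by rewrite -addn1 addnC -drop_drop IH drop1.
eapply (runs_weak X2).
  apply: (runs_iter (f := behead) (eB := enc_seq e) Ha Hb hp _) => G' x y j e1 _ Rx.
  exact: runs_tlS Rx.
lia.
Qed.

Lemma runs_nth A (e : A -> tree) x0 s n G a b k m p :
  e x0 = Leaf \/ n < size s ->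
  runs X G a (enc_nat n) k -> runs X G b (enc_seq e s) m -> n <= X ^ p ->
  runs X G (NTH a b) (e (nth x0 s n)) (k + m + p + 19).
Proof.
move=> h Ha Hb hp; rewrite -[n]addn0 -nth_drop nth0; eapply (runs_weak X2).
  apply: runs_hdS (runs_drop Ha Hb hp).
  by case: h => h; [left | right; rewrite size_drop subn_gt0].
lia.
Qed.

Lemma runs_ext_bits s G a k p : runs X G a (enc_seq enc_bits s) k -> size s <= X ^ p ->
  runs X G (EXT a) (enc_seq enc_bits (extb s)) (k + p + 100).
Proof.
move=> Ha hp; eapply (runs_weak X2).
  apply: (runs_fold X2 (f := fun acc w => [:: true :: w, false :: w & acc])
    (eB := enc_seq enc_bits) (b0 := [::]) Ha _ hp _); first exact: runs_nil.
  move=> G' x y v s1 s2 e1 _ Rx Ry.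
  apply: (runs_cons X2 (runs_cons X2 (runs_true) Ry)).
  exact: (runs_cons X2 (runs_cons X2 (runs_nil X2) Ry) Rx).
lia.
Qed.

Lemma runs_allb n G a k p : runs X G a (enc_nat n) k -> 2 ^ n <= X ^ p ->
  runs X G (ALLB a) (enc_seq enc_bits (allb n)) (k + p + p + 200).
Proof.
move=> Ha hp; eapply (runs_weak X2).
  apply: (runs_iter (f := extb) (eB := enc_seq enc_bits) (b0 := [:: [::]]) Ha _ _ _).
  - exact: (runs_cons X2 (runs_nil X2) (runs_nil X2)).
  - by apply: leq_trans hp; apply/ltnW/ltn_expl.
  move=> G' x y j e1 hj Rx; apply: (runs_ext_bits (p := p) Rx).
  by rewrite size_allb; apply: leq_trans hp; rewrite leq_exp2l // ltnW.
lia.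
Qed.

Lemma runs_iota n G a k p : runs X G a (enc_nat n) k -> n <= X ^ p ->
  runs X G (IOTA a) (enc_seq enc_nat (iotar n)) (k + p + p + 50).
Proof.
move=> Ha hp; eapply (runs_weak X2).
  apply: (runs_iter (f := fun s => size s :: s) (eB := enc_seq enc_nat) (b0 := [::]) Ha _ hp _).
    exact: runs_nil.
  move=> G' x y j e1 hj Rx; apply: (runs_cons X2 (runs_len (p := p) Rx _) Rx).
  by rewrite size_iotar; apply: leq_trans hp; rewrite ltnW.
lia.
Qed.

Lemma runs_positions b G a k p : runs X G a (enc_nat b) k -> 2 ^ b <= X ^ p ->
  runs X G (POSITIONS a) (enc_seq enc_pair (positions b)) (k + k + 10 * p + 600).
Proof.
move=> Ha hp.
have hb : b <= X ^ p by apply: leq_trans hp; apply/ltnW/ltn_expl.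
eapply (runs_weak X2).
  apply: (runs_fold X2 (eA := enc_nat) (eB := enc_seq enc_pair) (b0 := [::])
    (vs := iotar (2 ^ b)) (p := p)).
  - rewrite -(size_allb b).
    by apply: (runs_iota (p := p) (runs_len (p := p) (runs_allb Ha hp) _)); rewrite size_allb.
  - exact: runs_nil.
  - by rewrite size_iotar.
  move=> G' x y j s1 s2 e1 _ Rx Ry; lift e1.
  apply: (runs_fold X2 (eB := enc_seq enc_pair) (runs_iota Ha hb) Rx _ _).
    by rewrite size_iotar; exact: hb.
  move=> G2 x' y' t s3 s4 e2 _ Rx' Ry'; lift e2.
  exact: (runs_cons X2 (runs_cons X2 Ry Ry') Rx').
lia.
Qed.

Definition search n : nat :=
  iter n.+1 (fun b => if n < size (positions b) then b else b.+1) 0.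

Lemma runs_search n bm G a k p :
  (forall j, j <= n.+1 ->
    iter j (fun b => if n < size (positions b) then b else b.+1) 0 <= bm) ->
  2 ^ bm <= X ^ p -> n.+1 <= X ^ p -> runs X G a (enc_nat n) k ->
  runs X G (SEARCH a) (enc_nat (search n)) (k + k + 20 * p + 1000).
Proof.
move=> hm hp hn Ha; eapply (runs_weak X2).
  apply: (runs_iter (eB := enc_nat) (b0 := 0) (n := n.+1) _ _ hn _).
  - exact: (runs_cons X2 (runs_nil X2) Ha).
  - exact: runs_nil.
  move=> G' x y j e1 hj; set b := iter j _ _ => Rx; lift e1.
  have hb : 2 ^ b <= X ^ p.
    by apply: leq_trans hp; rewrite leq_exp2l // hm // ltnW.
  apply: (runs_if X2 (runs_drop Ha (runs_positions Rx hb) (ltnW hn))).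
    rewrite -subn_gt0 -size_drop; case: drop => //= *; exact: Rx.
  rewrite -subn_gt0 -size_drop; case: drop => //= *; exact: (runs_cons X2 (runs_nil X2) Rx).
lia.
Qed.

Definition enc_state (st : seq (seq bool) * seq (seq bool)) : tree :=
  Node (enc_seq enc_bits st.1) (enc_seq enc_bits st.2).

Lemma runs_decode vals g G a b k m p :
  runs X G a (enc_seq enc_bits vals) k -> runs X G b (enc_bits g) m -> size g <= X ^ p ->
  runs X G (DECODE a b) (enc_seq enc_bits (decode vals g)) (k + m + p + 200).
Proof.
move=> Ha Hb hp; eapply (runs_weak X2).
  apply: (runs_tlN (u := enc_seq enc_bits (foldl decode_step (vals, [::]) g).1)).
  apply: (runs_fold X2 (f := decode_step) (eB := enc_state) (b0 := (vals, [::])) Hb _ hp _).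
    exact: (runs_cons X2 Ha (runs_nil X2)).
  move=> G' x y t s1 s2 e1 _; case: (foldl _ _ _) => vs out Rx Ry.
  have R1 := runs_hdN Rx; have R2 := runs_tlN Rx.
  apply: (runs_if X2 Ry); case: t {Ry} => //= _.
    exact: (runs_cons X2 (runs_tlS R1) R2).
  exact: (runs_cons X2 R1 (runs_cons X2 (runs_hdS (x0 := [::]) (or_introl erefl) R1) R2)).
lia.
Qed.

End Specs.

Arguments runs_true {X} X2 {G}.

Definition CELLS (J labs o e sg acc : tm) : tm :=
  FOLD J acc (fun x r =>
    IF (EQB (NTH (TL e) (NTH r labs)) sg)
       (CONS (CONS (ADD o r) (ADD o (HD e))) x) x).
Definition CLAUSE_SET (Q J labs pos C : tm) : tm :=
  TL (FOLD C (CONS NIL NIL) (fun st l =>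
    CONS (ADD (HD st) Q) (CELLS J labs (HD st) (NTH (HD l) pos) (TL l) (TL st)))).
Definition OFFSETS (Q : tm) : tm := CONS NIL (CONS Q (CONS (ADD Q Q) NIL)).
Definition PAIR_SETS (Q J labs pos : tm) : tm :=
  FOLD pos NIL (fun x e => FOLD (OFFSETS Q) x (fun y c => FOLD (OFFSETS Q) y
    (fun z d => CONS (CELLS J labs c e TRUE (CELLS J labs d e NIL NIL)) z))).
Definition HS_LISTS (Q J labs pos cls : tm) : tm :=
  FOLD cls (PAIR_SETS Q J labs pos) (fun x C => CONS (CLAUSE_SET Q J labs pos C) x).
Definition INSTANCE (Q J labs pos cls : tm) : tm :=
  CONS (ADD Q (ADD Q Q)) (HS_LISTS Q J labs pos cls).
(** The accumulator [x] is the disjunction of the answers so far; all data that do not depend on the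
    guess are computed before the loop. *)
Definition MAIN (p : cmd) (F : tm) : tm :=
  LET (SEARCH (HD F)) (fun b =>
  LET (ALLB b) (fun vals =>
  LET (LEN vals) (fun Q =>
  LET (IOTA Q) (fun J =>
  LET (POSITIONS b) (fun pos =>
  FOLD (ALLB (ADD Q Q)) NIL (fun x g =>
    LET (DECODE vals g) (fun labs =>
    IF (CALL p (INSTANCE Q J labs pos (TL F))) TRUE x))))))).

(** * Correctness and running time of the construction of an instance *)

Section Specs.
Variables (X : nat) (X2 : 1 < X).
Implicit Types (G : seq tree).

Lemma runs_cells q labs o e sg acc G J L O E S A kJ kL kO kE kS kA p :
  runs X G J (enc_seq enc_nat (iotar q)) kJ ->
  runs X G L (enc_seq enc_bits labs) kL ->
  runs X G O (enc_nat o) kO -> runs X G E (enc_pair e) kE ->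
  runs X G S (enc_bool sg) kS -> runs X G A (enc_seq enc_pair acc) kA ->
  q <= X ^ p -> o <= X ^ p -> e.2 <= X ^ p ->
  runs X G (CELLS J L O E S A) (enc_seq enc_pair (cells q labs o e sg acc))
    (kJ + kL + 2 * kO + 2 * kE + 2 * kS + kA + 10 * p + 300).
Proof.
move=> HJ HL HO HE HS HA hq ho he; eapply (runs_weak X2).
  apply: (runs_fold X2 (eB := enc_seq enc_pair) (p := p) HJ HA _ _).
    by rewrite size_iotar.
  move=> G' x y r s1 s2 e1 dJ; set acc' := foldl _ _ _ => Rx Ry; lift e1.
  have hr : r < q by rewrite -mem_iotar dJ mem_cat mem_head orbT.
  have Rl := runs_nth X2 (or_introl erefl) Ry HL (leq_trans (ltnW hr) hq) (x0 := [::]).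
  have Rb := runs_nth X2 (or_introl erefl) (runs_tlN X2 HE) Rl he (x0 := false).
  apply: (runs_if X2 (runs_eqb X2 Rb HS)); rewrite /label; case: (_ == _) => // _.
    apply: (runs_cons X2 _ Rx).
    exact: (runs_cons X2 (runs_add X2 HO Ry ho) (runs_add X2 HO (runs_hdN X2 HE) ho)).
  exact: Rx.
lia.
Qed.

Section Sets.
Variables (b p : nat) (labs : seq (seq bool)).
Let q := 2 ^ b.
Let pos := positions b.
Hypothesis hq : 3 * q <= X ^ p.

Let q_le : q <= X ^ p.
Proof. by apply: leq_trans hq; lia. Qed.

Let pos_le (e : nat * nat) : e.2 < b -> e.2 <= X ^ p.
Proof. by move=> /leq_trans h; apply: leq_trans q_le; apply/ltnW/h/ltnW/ltn_expl. Qed.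

Definition enc_st (st : nat * seq (nat * nat)) : tree :=
  Node (enc_nat st.1) (enc_seq enc_pair st.2).

Lemma runs_clause_set C n G Q J L P c kQ kJ kL kP kC :
  runs X G Q (enc_nat q) kQ -> runs X G J (enc_seq enc_nat (iotar q)) kJ ->
  runs X G L (enc_seq enc_bits labs) kL -> runs X G P (enc_seq enc_pair pos) kP ->
  runs X G c (enc_seq enc_lit C) kC ->
  size C <= 3 -> (forall l, l \in C -> l.1 < size pos) -> size pos <= X ^ n ->
  runs X G (CLAUSE_SET Q J L P c) (enc_seq enc_pair (clause_set q labs pos C))
    (kQ + kJ + kL + 2 * kP + kC + 13 * p + 2 * n + 800).
Proof.
move=> HQ HJ HL HP Hc h3 hl hn; eapply (runs_weak X2).
  apply: (runs_tlN X2 (u := enc_nat (foldl (clause_step q labs pos) (0, [::]) C).1)).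
  apply: (runs_fold X2 (f := clause_step q labs pos) (eB := enc_st) (b0 := (0, [::]))
    (p := 2) Hc).
  - exact: (runs_cons X2 (runs_nil X2) (runs_nil X2)).
  - exact: leq_trans h3 (ltnW (leq4_powX X2)).
  move=> G' x y l s1 s2 e1 dC.
  have szs : size s1 <= 2 by move/(congr1 size): dC; rewrite size_cat /=; lia.
  (* At most two literals precede the current one, so the running offset stays below
     [3 * q <= X ^ p]. *)
  have : (foldl (clause_step q labs pos) (0, [::]) s1).1 = size s1 * q.
    rewrite -[RHS]add0n -[X in X + _]/((0, [::] : seq (nat * nat)).1).
    elim: (s1) (0, [::]) => [|l' s IH] st /=; first by rewrite addn0.
    by rewrite IH /= mulSn addnA.
  case: (foldl _ _ _) => o acc /= -> Rx Ry; lift e1.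
  have {}hl : l.1 < size pos by apply: hl; rewrite dC mem_cat mem_head orbT.
  have ho : size s1 * q <= X ^ p by apply: leq_trans hq; rewrite leq_mul2r leqW ?orbT.
  have R1 := runs_hdN X2 Rx; have R2 := runs_tlN X2 Rx.
  have Re := runs_nth X2 (or_intror hl) (runs_hdN X2 Ry) HP (leq_trans (ltnW hl) hn) (x0 := (0, 0)).
  apply: (runs_cons X2 (runs_add X2 R1 HQ ho)).
  apply: (runs_cells (p := p) HJ HL R1 Re (runs_tlN X2 Ry) R2) => //.
  by apply: pos_le; have := mem_nth (0, 0) hl; rewrite mem_positions => /andP[].
lia.
Qed.

Lemma runs_offsets G Q kQ : runs X G Q (enc_nat q) kQ ->
  runs X G (OFFSETS Q) (enc_seq enc_nat (offsets q)) (3 * kQ + p + 50).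
Proof.
move=> HQ; eapply (runs_weak X2).
  apply: (runs_cons X2 (runs_nil X2) (runs_cons X2 HQ _)).
  exact: (runs_cons X2 (runs_add X2 HQ HQ q_le) (runs_nil X2)).
lia.
Qed.

Lemma offset_le o : o \in offsets q -> o <= X ^ p.
Proof. by move=> h; apply: leq_trans hq; move: h; rewrite !inE => /or3P[] /eqP ->; lia. Qed.

Definition enc_sets : seq (seq (nat * nat)) -> tree := enc_seq (enc_seq enc_pair).

Lemma runs_pair_sets n G Q J L P kQ kJ kL kP :
  runs X G Q (enc_nat q) kQ -> runs X G J (enc_seq enc_nat (iotar q)) kJ ->
  runs X G L (enc_seq enc_bits labs) kL -> runs X G P (enc_seq enc_pair pos) kP ->
  size pos <= X ^ n ->
  runs X G (PAIR_SETS Q J L P) (enc_sets (pair_sets q labs pos))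
    (6 * kQ + 2 * kJ + 2 * kL + kP + 30 * p + n + 1000).
Proof.
move=> HQ HJ HL HP hn; eapply (runs_weak X2).
  apply: (runs_fold X2 (eB := enc_sets) (b0 := [::]) HP (runs_nil X2) hn).
  move=> G1 x y e s1 s2 e1 dp; set acc1 := foldl _ _ _ => Rx Re; lift e1.
  have he : e.2 <= X ^ p.
    apply: pos_le; have : e \in pos by rewrite dp mem_cat mem_head orbT.
    by rewrite mem_positions => /andP[].
  apply: (runs_fold X2 (eB := enc_sets) (p := 2) (runs_offsets HQ) Rx (ltnW (leq4_powX X2))).
  move=> G2 x2 y2 c s3 s4 e2 dc; set acc2 := foldl _ _ _ => Rx2 Rc; lift e2.
  apply: (runs_fold X2 (eB := enc_sets) (p := 2) (runs_offsets HQ) Rx2 (ltnW (leq4_powX X2))).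
  move=> G3 x3 y3 d s5 s6 e3 dd; set acc3 := foldl _ _ _ => Rx3 Rd; lift e3.
  have hc : c <= X ^ p by apply: offset_le; rewrite dc mem_cat mem_head orbT.
  have hd : d <= X ^ p by apply: offset_le; rewrite dd mem_cat mem_head orbT.
  have R1 := runs_cells (acc := [::]) HJ HL Rd Re
    (runs_nil X2 : runs X G3 NIL (enc_bool false) 1) (runs_nil X2) q_le hd he.
  exact: (runs_cons X2 (runs_cells HJ HL Rc Re (runs_true X2) R1 q_le hc he) Rx3).
lia.
Qed.

Definition enc_cls : seq (seq (nat * bool)) -> tree := enc_seq (enc_seq enc_lit).

Lemma runs_hs_lists cls n G Q J L P c kQ kJ kL kP kC :
  runs X G Q (enc_nat q) kQ -> runs X G J (enc_seq enc_nat (iotar q)) kJ ->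
  runs X G L (enc_seq enc_bits labs) kL -> runs X G P (enc_seq enc_pair pos) kP ->
  runs X G c (enc_cls cls) kC ->
  (forall C, C \in cls -> clause_ok pos C) ->
  size pos <= X ^ n -> size cls <= X ^ n ->
  runs X G (HS_LISTS Q J L P c) (enc_sets (hs_lists q labs pos cls))
    (7 * kQ + 3 * kJ + 3 * kL + 3 * kP + kC + 50 * p + 5 * n + 2000).
Proof.
move=> HQ HJ HL HP Hc cls_ok hn hm; eapply (runs_weak X2).
  apply: (runs_fold X2 (eB := enc_sets) Hc (runs_pair_sets HQ HJ HL HP hn) hm).
  move=> G1 x y C s1 s2 e1 dC; set acc1 := foldl _ _ _ => Rx Ry; lift e1.
  have [h3 hl] : clause_ok pos C by apply: cls_ok; rewrite dC mem_cat mem_head orbT.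
  exact: (runs_cons X2 (runs_clause_set HQ HJ HL HP Ry h3 hl hn) Rx).
lia.
Qed.

Lemma runs_instance cls n G Q J L P c kQ kJ kL kP kC :
  runs X G Q (enc_nat q) kQ -> runs X G J (enc_seq enc_nat (iotar q)) kJ ->
  runs X G L (enc_seq enc_bits labs) kL -> runs X G P (enc_seq enc_pair pos) kP ->
  runs X G c (enc_cls cls) kC ->
  (forall C, C \in cls -> clause_ok pos C) ->
  size pos <= X ^ n -> size cls <= X ^ n ->
  runs X G (INSTANCE Q J L P c)
    (Node (enc_nat (3 * q)) (enc_sets (hs_lists q labs pos cls)))
    (10 * kQ + 3 * kJ + 3 * kL + 3 * kP + kC + 60 * p + 5 * n + 2500).
Proof.
move=> HQ HJ HL HP Hc cls_ok hn hm.
have -> : 3 * q = q + (q + q) by lia.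
eapply (runs_weak X2).
  apply: (runs_cons X2 (runs_add X2 HQ (runs_add X2 HQ HQ q_le) q_le)).
  exact: (runs_hs_lists HQ HJ HL HP Hc cls_ok hn hm).
lia.
Qed.

End Sets.
End Specs.

(** The iteration climbs by one to the least admissible [b] and then stays, so its [j]-th value is
    [minn j b]. As [n.+1] is admissible, [n.+1] rounds suffice. *)
Lemma searchP n : let b := search n in
  [/\ n < 2 ^ b * b, forall j, n < 2 ^ j * j -> b <= j &
    forall j, iter j (fun b => if n < size (positions b) then b else b.+1) 0 <= b].
Proof.
have ex : exists b, n < 2 ^ b * b.
  by exists n.+1; apply: leq_pmull; rewrite expn_gt0.
case: (ex_minnP ex) => b hb bmin.
have iterE j : iter j (fun b => if n < size (positions b) then b else b.+1) 0 = minn j b.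
  elim: j => [|j IH] /=; first by rewrite min0n.
  rewrite IH size_positions; case: (ltnP j b) => hj.
    rewrite (minn_idPl hj); case: ifP => // /bmin; lia.
  by rewrite hb (minn_idPr (leqW hj)).
have -> : search n = b.
  rewrite /search iterE; apply/minn_idPr/bmin.
  by apply: leq_pmull; rewrite expn_gt0.
by split=> // j; rewrite iterE geq_minr.
Qed.

(** * The loop over all guesses *)

Section Main.
Variables (X : nat) (X2 : 1 < X) (prog : cmd) (n m p : nat).
Variables (cls : seq (seq (nat * bool))) (yes : seq bool -> bool).
Let b := search n.
Let q := 2 ^ b.
Hypothesis cls_ok : forall C, C \in cls -> clause_ok (positions b) C.
Hypothesis size_cls : size cls <= X ^ p.
Hypothesis guesses_le : 2 ^ (q + q) <= X ^ p.
Hypothesis prog_ok : forall g, size g = q + q -> exists t s,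
  [/\ exec prog (init (Node (enc_nat (3 * q))
        (enc_sets (hs_lists q (decode (allb b) g) (positions b) cls)))) t s,
    t <= X ^ m & s 0 <> Leaf <-> yes g].

Lemma runs_main G F k : runs X G F (Node (enc_nat n) (enc_cls cls)) k ->
  runs X G (MAIN prog F) (enc_bool (has yes (allb (q + q))))
    (10 * k + 200 * p + 2 * cbound prog + m + 80 * 80).
Proof.
move=> HF; have [n_lt _ search_le] := searchP n; rewrite -/b in n_lt search_le.
(* The bound on the number of guesses also dominates [q], the number of positions and [n]. *)
have le_pow x y : x <= 2 ^ y -> y <= q + q -> x <= X ^ p.
  by move=> hx hy; apply: leq_trans hx (leq_trans _ guesses_le); rewrite leq_exp2l.
have b_lt : b < q by apply: ltn_expl.
have q_le : q <= X ^ p by apply: (le_pow _ b) => //; lia.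
have qq_le : q + q <= X ^ p by apply: leq_trans guesses_le; apply/ltnW/ltn_expl.
have pos_le : size (positions b) <= X ^ p.
  apply: (le_pow _ (b + b)); last lia.
  by rewrite size_positions expnD leq_mul2l ltnW ?orbT // ltn_expl.
have q3_le : 3 * q <= X ^ (2 + p).
  exact: leq_pow_mul (ltnW (leq4_powX X2)) q_le.
have n_le : n.+1 <= X ^ p by apply: leq_trans n_lt _; rewrite -size_positions.
eapply (runs_weak X2).
  apply: (runs_let X2 (runs_search X2 (fun j _ => search_le j) q_le n_le (runs_hdN X2 HF))).
  move=> G1 vb e1 Rb; lift e1.
  apply: (runs_let X2 (runs_allb X2 Rb q_le)) => G2 vals e2 Rvals; lift e2.
  apply: (runs_let X2 (runs_len (p := p) X2 Rvals _)) => [|G3 Q e3]; first by rewrite size_allb.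
  rewrite size_allb => RQ; lift e3.
  apply: (runs_let X2 (runs_iota X2 RQ q_le)) => G4 J e4 RJ; lift e4.
  apply: (runs_let X2 (runs_positions X2 Rb q_le)) => G5 P e5 RP; lift e5.
  (* The initial accumulator [false] is exposed so that the disjunction can be proved equal to the
     fold by induction on a general accumulator. *)
  rewrite -[has _ _]/(false || has yes (allb (q + q))).
  have -> : false || has yes (allb (q + q)) =
      foldl (fun x g => if yes g then true else x) false (allb (q + q)).
    elim: (allb _) false => [|g s IH] x /=; first by rewrite orbF.
    by rewrite -IH; case: (yes g); case: x.
  apply: (runs_fold X2 (eB := enc_bool) (b0 := false)
    (f := fun x g => if yes g then true else x) (p := p)
    (runs_allb (p := p) X2 (runs_add X2 RQ RQ q_le) guesses_le) (runs_nil X2)).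
    by rewrite size_allb.
  move=> G6 x y g s1 s2 e6 dg; set acc := foldl _ _ _ => Rx Ry; lift e6.
  have hg : size g = q + q.
    by apply/eqP; rewrite -mem_allb dg mem_cat mem_head orbT.
  apply: (runs_let X2 (runs_decode X2 Rvals Ry _)) => [|G7 L e7 RL].
    by rewrite hg; exact: qq_le.
  lift e7; have [t [s' [E le_t ok]]] := prog_ok hg.
  have RI := runs_instance X2 q3_le RQ RJ RL RP (runs_tlN X2 HF) cls_ok pos_le size_cls.
  apply: (runs_if X2 (runs_call X2 RI E le_t)).
    by move/ok => ->; exact: (runs_true X2).
  move=> no; have -> : yes g = false by apply/negP => /ok.
  exact: Rx.
lia.
Qed.

End Main.

(** * Encodings, sizes and growth rates *)

Lemma enc_seq_map A B (eA : A -> tree) (eB : B -> tree) (f : A -> B) s :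
  (forall x, eB (f x) = eA x) -> enc_seq eB (map f s) = enc_seq eA s.
Proof. by move=> H; elim: s => //= x s ->; rewrite H. Qed.

Lemma enc_seq_map_in (A : eqType) B (eA : A -> tree) (eB : B -> tree) (f : A -> B) s :
  {in s, forall x, eB (f x) = eA x} -> enc_seq eB (map f s) = enc_seq eA s.
Proof.
elim: s => //= x s IH H; rewrite H ?mem_head // IH // => y hy.
by rewrite H // inE hy orbT.
Qed.

Lemma tsize_enc_nat n : Defs.tsize (enc_nat n) = n.*2.+1.
Proof. by elim: n => //= n ->. Qed.

Lemma tsize_enc_seq (A : eqType) (e : A -> tree) B s :
  {in s, forall x, Defs.tsize (e x) <= B} -> Defs.tsize (enc_seq e s) <= size s * B.+1 + 1.
Proof.
elim: s => //= x s IH H; rewrite mulSn.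
have h1 := H _ (mem_head _ _); have: Defs.tsize (enc_seq e s) <= size s * B.+1 + 1.
  by apply: IH => y hy; rewrite H // inE hy orbT.
lia.
Qed.

Definition nat_clauses (F : cnf) : seq (seq (nat * bool)) :=
  [seq [seq (nat_of_ord l.1, l.2) | l <- C] | C <- clauses F].

Lemma enc_cnfE F : enc_cnf F = Node (enc_nat (nvars F)) (enc_cls (nat_clauses F)).
Proof. by congr Node; symmetry; apply: enc_seq_map => C; apply: enc_seq_map. Qed.

(** The clauses are distinct, and each is determined by a triple of optional literals, with
    [2 * n + 1] choices per entry. *)
Lemma size_clauses F : is_3cnf F -> size (clauses F) <= ((nvars F).*2.+1) ^ 3.
Proof.
case=> U h3; pose f C := [tuple onth C i | i < 3] : 3.-tuple (option (literal (nvars F))).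
have f_inj : {in clauses F &, injective f}.
  move=> C D hC hD E.
  have H i : i < 3 -> onth C i = onth D i.
    move=> hi; have := congr1 (fun t => tnth t (Ordinal hi)) E.
    by rewrite !tnth_mktuple.
  apply: eq_from_onth_le => i hi; apply: H; apply: leq_trans hi _.
  by rewrite geq_max !h3.
have : uniq (map f (clauses F)) by rewrite map_inj_in_uniq.
move/card_uniqP; rewrite size_map => <-; apply: leq_trans (max_card _) _.
by rewrite card_tuple card_option card_prod card_ord card_bool muln2.
Qed.

Lemma satisfiable_nat F : satisfiable F <-> exists a : nat -> bool,
  forall C, C \in nat_clauses F -> exists2 l, l \in C & a l.1 = l.2.
Proof.
split=> [[a Ha]|[a Ha]].
  (* The value outside the range of the variables is arbitrary. *)
  exists (fun x => if insub x is Some i then a i else false).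
  move=> _ /mapP[C hC ->]; have [l hl al] := Ha C hC.
  by exists (l.1 : nat, l.2); [apply/mapP; exists l | rewrite /= valK].
exists (fun i => a i) => C hC.
have [|_ /mapP[l hl ->] al] := Ha [seq (nat_of_ord l.1, l.2) | l <- C].
  by apply/mapP; exists C.
by exists l.
Qed.

(** A boolean form, as the answers for the different guesses are combined by [has]. *)
Definition hittable (H : hs_instance) : bool :=
  [exists rho : {ffun 'I_(hs_k H) -> 'I_(hs_k H)},
    all (fun S => [exists i, (i, rho i) \in S]) (hs_sets H)].

Lemma hittableP H : reflect (has_hitting_set H) (hittable H).
Proof.
apply: (iffP existsP) => [[rho /allP h]|[rho h]].
  by exists rho => S /h /existsP.
exists [ffun i => rho i]; apply/allP => S /h [i hi]; apply/existsP; exists i.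
by rewrite ffunE.
Qed.

(** * Passing from lists of pairs of numbers to hitting set instances *)

Section Instance.
Variables (K : nat) (K0 : 0 < K) (sets : seq (seq (nat * nat))).

Definition to_ord (i : nat) : 'I_K := insubd (Ordinal K0) i.

Definition to_cell (u : nat * nat) : cell K := (to_ord u.1, to_ord u.2).

Definition hs_of : hs_instance := HSInstance (map (map to_cell) sets).

Hypothesis bound : forall S u, S \in sets -> u \in S -> u.1 < K /\ u.2 < K.

Lemma to_ordK i : i < K -> to_ord i = i :> nat.
Proof. by move=> hi; rewrite val_insubd hi. Qed.

Lemma enc_hs_of : enc_hs hs_of = Node (enc_nat K) (enc_sets sets).
Proof.
congr Node; apply: enc_seq_map_in => S hS; apply: enc_seq_map_in => u hu.
by have [h1 h2] := bound hS hu; rewrite /enc_cell /to_cell /= !to_ordK.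
Qed.

Lemma hs_of_thin :
  (forall S u w, S \in sets -> u \in S -> w \in S -> u.1 = w.1 -> u = w) ->
  at_most_one_per_row hs_of.
Proof.
move=> thin _ /mapP[S hS ->] _ _ /mapP[u hu ->] /mapP[w hw ->] /= E.
have [hu1 _] := bound hS hu; have [hw1 _] := bound hS hw.
by rewrite (thin S u w) // -(to_ordK hu1) -(to_ordK hw1) E.
Qed.

Lemma hs_of_hit : has_hitting_set hs_of <-> exists2 rho : nat -> nat,
  (forall i, i < K -> rho i < K) &
  forall S, S \in sets -> exists2 i, i < K & (i, rho i) \in S.
Proof.
split=> [[rho H]|[rho rho_lt H]].
  exists (fun i => rho (to_ord i)) => // S hS.
  have [|i /mapP[u hu [Ei Er]]] := H (map to_cell S); first exact: map_f.
  have [h1 h2] := bound hS hu; exists u.1 => //.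
  by rewrite -Ei Er to_ordK // -surjective_pairing.
exists (fun i => to_ord (rho i)) => _ /mapP[S hS ->].
have [i hi hu] := H S hS; exists (to_ord i).
by apply/mapP; exists (i, rho i); rewrite // /to_cell /= to_ordK.
Qed.

Lemma tsize_hs_of M : (forall S, S \in sets -> size S <= M) ->
  Defs.tsize (enc_hs hs_of) <= 2 * K + 3 + size sets * (M * (4 * K + 4) + 2).
Proof.
move=> hM; rewrite enc_hs_of /= tsize_enc_nat.
have h : Defs.tsize (enc_sets sets) <= size sets * (M * (4 * K + 4) + 1).+1 + 1.
  apply: tsize_enc_seq => S hS; apply: leq_trans (_ : size S * (4 * K + 4) + 1 <= _).
    rewrite (addnS _ 3); apply: tsize_enc_seq => -[i j] hu; rewrite /enc_pair /= !tsize_enc_nat.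
    by have [/= h1 h2] := bound hS hu; lia.
  by rewrite leq_add2r leq_mul2r hM ?orbT.
by move: h; rewrite -addn1 -addnA; lia.
Qed.

End Instance.

(** * Growth of the parameter *)

Lemma trunc_log_3pow2 b : trunc_log 2 (3 * 2 ^ b) = b.+1.
Proof.
apply: trunc_log_eq => //; rewrite !expnS; apply/andP; split; first by rewrite leq_mul2r orbT.
by rewrite mulnA ltn_mul2r expn_gt0.
Qed.

(** Minimality of [b] gives [2 ^ b.-1 * b.-1 <= n]. For [k = 3 * 2 ^ b] this makes
    [k * log k = 3 * 2 ^ b * b.+1] at most [12 * n], so the constant 24 bounds the [g] term by
    [n / 2]; the term [2 ^ b] gets the other half. *)
Lemma little_o_search g C : little_o g (fun k => k * trunc_log 2 k) ->
  little_o (fun n => (2 ^ search n + g (3 * 2 ^ search n)) * C) (fun n => n).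
Proof.
move=> Hg c; have [k0 Hk0] := Hg (24 * (c * C)).
(* From [b0 < b] follow [k0 <= 3 * 2 ^ b], [4 * (c * C) <= b.-1] and [b.+1 <= 2 * b.-1], one from
   each summand. *)
pose b0 := k0 + 4 * (c * C) + 3.
exists (2 ^ b0 * b0) => n hn; have [n_lt bmin _] := searchP n.
set b := search n in n_lt bmin *.
have hb : b0 < b.
  rewrite ltnNge; apply/negP => le_b; move: n_lt; rewrite ltnNge => /negP; apply.
  by apply: leq_trans hn; rewrite leq_mul // leq_exp2l.
have prev : 2 ^ b.-1 * b.-1 <= n.
  by rewrite leqNgt; apply/negP => /bmin; lia.
have pow : 2 ^ b = 2 * 2 ^ b.-1 by rewrite -expnS prednK //; lia.
have := Hk0 (3 * 2 ^ b); rewrite trunc_log_3pow2 => /(_ _) hg.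
have {hg} : 24 * (c * C) * g (3 * 2 ^ b) <= 3 * 2 ^ b * b.+1.
  by apply: hg; have := ltn_expl b (isT : 1 < 2); lia.
set G := g _; rewrite pow; set P := 2 ^ b.-1 in prev pow *.
have : 4 * (c * C) <= b.-1 by lia.
have : b.+1 <= 2 * b.-1 by lia.
rewrite (_ : c * ((2 * P + G) * C) = 2 * P * (c * C) + c * C * G); last lia.
set D := c * C; set B := b.-1 in prev *; move=> h1 h2 h3.
have h4 : P * (4 * D) <= P * B by rewrite leq_mul2l h2 orbT.
have h5 : P * b.+1 <= P * (2 * B) by rewrite leq_mul2l h1 orbT.
nia.
Qed.

(** * The reduction *)

Section Oracle.
Variables (prog : cmd) (g : nat -> nat) (c : nat).
Hypothesis prog_ok : decides_in_time enc_hs at_most_one_per_row has_hitting_set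
  (fun H => 2 ^ g (hs_k H) * Defs.tsize (enc_hs H) ^ c) prog.
Variable F : cnf.
Hypothesis F3 : is_3cnf F.

Let b := search (nvars F).
Let q := 2 ^ b.
(** One base for all bounds: the [2 ^ (2 * q)] guesses, the polynomial factors and the factor
    [2 ^ g (3 * q)] of a call are all powers of [X] with exponents independent of the formula. *)
Let X := 2 ^ (q + g (3 * q)).
Let cls := nat_clauses F.
Let K0 : 0 < 3 * q. Proof. by rewrite muln_gt0 expn_gt0. Qed.
Let H_of (w : seq bool) : hs_instance :=
  hs_of K0 (hs_lists q (decode (allb b) w) (positions b) cls).

Let q_gt0 : 0 < q. Proof. by rewrite expn_gt0. Qed.

Let X2 : 1 < X.
Proof. by rewrite (ltn_exp2l 0) // addn_gt0 q_gt0. Qed.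

Let q_leX : q <= X.
Proof. by rewrite leq_exp2l // (leq_trans (ltnW (ltn_expl b (isT : 1 < 2)))) // leq_addr. Qed.

Let b_lt : b < q. Proof. exact: ltn_expl. Qed.

Let pow_leX k : 2 ^ (q * k) <= X ^ k.
Proof. by rewrite expnM; case: k => // k; rewrite leq_exp2r // leq_exp2l // leq_addr. Qed.

Let cls_ok C : C \in cls -> clause_ok (positions b) C.
Proof.
move=> /mapP[D hD ->]; split; first by rewrite size_map; case: F3 => _; apply.
move=> _ /mapP[l hl ->] /=; have [n_lt _ _] := searchP (nvars F).
by rewrite size_positions; apply: leq_trans n_lt; rewrite ltnS ltnW.
Qed.

Let size_cls : size cls <= X ^ 6.
Proof.
rewrite size_map; apply: leq_trans (size_clauses F3) _.
(* With [n < 2 ^ b * b] and [b < q], one has [2 * n + 1 <= 2 ^ (2 * b + 1) <= 2 ^ (2 * q)]; cubing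
   gives the exponent 6. *)
rewrite -[6]/(2 * 3) expnM leq_exp2r //; apply: leq_trans (pow_leX 2).
have [n_lt _ _] := searchP (nvars F); rewrite -/b in n_lt.
have h1 : 2 ^ b * b <= 2 ^ (b + b).
  by rewrite expnD leq_mul2l ltnW ?orbT // ltn_expl.
apply: leq_trans (_ : 2 ^ (b + b).+1 <= _); first by rewrite expnS; lia.
by rewrite leq_exp2l //; lia.
Qed.

Let pos_lt e : e \in positions b -> e.1 < q.
Proof. by rewrite mem_positions => /andP[]. Qed.

Let n_lt : nvars F < q * b.
Proof. by have [] := searchP (nvars F). Qed.

Section Guess.
Variable w : seq bool.
Let sets := hs_lists q (decode (allb b) w) (positions b) cls.

Let bound A u : A \in sets -> u \in A -> u.1 < 3 * q /\ u.2 < 3 * q.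
Proof. exact: (hs_lists_bound pos_lt cls_ok). Qed.

Let H := hs_of K0 sets.

Let set_size A : A \in sets -> size A <= 3 * q.
Proof.
case/mem_hs_lists => [[C hC ->]|[e [i [j [_ _ _ ->]]]]].
  apply: leq_trans (size_clause_set _ _ _ _) _.
  by rewrite leq_mul2r; case: (cls_ok hC) => ->; rewrite orbT.
apply: leq_trans (size_cells _ _ _ _ _ _) _.
by have := size_cells q (decode (allb b) w) j e false [::]; rewrite /=; lia.
Qed.

(** The instance keeps the promise, so the given algorithm answers correctly. The exponent 1
    accounts for [2 ^ g (3 * q)], and [X ^ 50] bounds the input size. *)
Lemma oracle_call : exists t s,
  [/\ exec prog (init (Node (enc_nat (3 * q)) (enc_sets sets))) t s,
    t <= X ^ (1 + 50 * c) & s 0 <> Leaf <-> hittable H].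
Proof.
have thin : at_most_one_per_row H.
  by apply: (hs_of_thin bound) => A u v; exact: (hs_lists_thin cls_ok).
have [t [s [E le_t ok]]] := prog_ok thin.
exists t, s; split; first by rewrite -enc_hs_of.
- apply: leq_trans le_t _; apply: leq_pow_mul; first by rewrite expn1 leq_exp2l // leq_addl.
  rewrite expnM; case: (c) => // c'; rewrite leq_exp2r //.
  apply: leq_trans (tsize_hs_of K0 bound set_size) _.
  have hq : 3 * q <= X ^ 3.
    by apply: (@leq_pow_mul _ _ _ 2 1) (ltnW (leq4_powX X2)) _; rewrite expn1.
  have hM : size sets <= X ^ (6 + (2 + 9)).+1.
    rewrite size_hs_lists size_positions; apply: leq_pow_add => //.
    apply: leq_pow_mul (leq_powX X2 9); apply: leq_mul => //.
    exact: leq_trans (ltnW b_lt) q_leX.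
  (* The terms of [tsize_hs_of] add up to the exponent 46, which is rounded up to 50. *)
  apply: (leq_powW X2 (leq_pow_add X2
    (leq_pow_add X2 (leq_pow_mul (leq_powX X2 2) hq) (leq_powX X2 3))
    (leq_pow_mul hM (leq_pow_add X2 (leq_pow_mul hq
      (leq_pow_add X2 (leq_pow_mul (leq_powX X2 4) hq) (leq_powX X2 4)))
      (leq_powX X2 2)))) _) => //.
- by rewrite ok; split=> /hittableP.
Qed.

Lemma hittable_sound : hittable H -> satisfiable F.
Proof.
move=> /hittableP/(hs_of_hit K0 bound)[rho _ rho_hit].
apply/satisfiable_nat; apply: (hs_lists_sound cls_ok rho_hit) => j hj.
(* Bit 0 exists in every group: [b = 0] would contradict [nvars F < q * b]. *)
by exists 0; rewrite mem_positions hj /=; move: n_lt; case: b; rewrite ?muln0.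
Qed.

Lemma hittable_hit rho : (forall i, i < 3 * q -> rho i < 3 * q) ->
  (forall A, A \in sets -> hit q rho A) -> hittable H.
Proof. by move=> h1 h2; apply/hittableP/(hs_of_hit K0 bound); exists rho. Qed.

End Guess.

(** A hittable instance certifies satisfiability whatever the guess, so wrong guesses do no harm; a
    satisfying assignment supplies a right one. *)
Lemma some_guess_hittable :
  has (fun w => hittable (H_of w)) (allb (q + q)) <-> satisfiable F.
Proof.
split=> [/hasP[w _]|/satisfiable_nat[a sat]]; first exact: hittable_sound.
have [w hw [rho rho_lt rho_hit]] := hs_lists_complete cls_ok sat.
apply/hasP; exists w; first by rewrite mem_allb hw mul2n addnn.
exact: (hittable_hit rho_lt rho_hit).
Qed.

(** The main program runs at depth 1, above the input in variable 0, and the last assignment moves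
    its result to the output variable. *)
Lemma reduction_run : exists t s,
  [/\ exec (Seq (MAIN prog (VAR 0) 1) (Assign 0 (EVar 1))) (init (enc_cnf F)) t s,
    t <= X ^ (50 * c + 2 * cbound prog + 100 * 100) & s 0 <> Leaf <-> satisfiable F].
Proof.
have guesses_le : 2 ^ (q + q) <= X ^ 6.
  by have := pow_leX 2; rewrite muln2 -addnn => /(leq_powW X2); apply.
have RF : runs X [:: enc_cnf F] (VAR 0) (Node (enc_nat (nvars F)) (enc_cls cls)) 1.
  by rewrite -enc_cnfE; apply: (runs_var X2).
have [|t [s [E le_t V _]]] := runs_main X2 cls_ok size_cls guesses_le
  (fun w _ => oracle_call w) RF (s := init (enc_cnf F)) (ext_refl _).
  by case.
exists (t + 2), (update s 0 (s 1)); split.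
- by apply: ExecSeq E _; apply: (ExecAssign 0 (EVar 1)).
- apply: (leq_powW X2 (leq_pow_add X2 le_t (leq_powX X2 2)) _); lia.
- rewrite updateE V -some_guess_hittable; case: (has _ _); split=> //.
Qed.

End Oracle.

Theorem theorem12 (eth : ETH) :
  ~ hs_solvable (fun _ => True) /\ ~ hs_solvable at_most_one_per_row.
Proof.
have thin : ~ hs_solvable at_most_one_per_row.
  move=> [prog [g [c [g_small prog_ok]]]]; apply: eth.
  exists (Seq (MAIN prog (VAR 0) 1) (Assign 0 (EVar 1))).
  (* The exponent of 2 in the time bound of [reduction_run], once its base is written as
     [2 ^ (q + g (3 * q))]. *)
  exists (fun n => (2 ^ search n + g (3 * 2 ^ search n)) *
    (50 * c + 2 * cbound prog + 100 * 100)).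
  split=> [|F F3]; first exact: little_o_search.
  by have [t [s []]] := reduction_run prog_ok F3; rewrite -expnM; exists t, s.
(* An algorithm for all instances also solves the restricted ones, in the same time. *)
split=> // -[prog [g [c [g_small prog_ok]]]]; apply: thin.
by exists prog, g, c; split=> // H _; apply: prog_ok.
Qed.
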